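(* Let $m\ge1$ be an integer and let $L_{2m}^{1/2}$ be the half-lune obtained by slicing the lune $L_{2m}\subset S^2$ along the equator. Let $N_N^+,N_N^-,N_D^+,N_D^-$ be the eigenvalue counting functions of $-\Delta$ on $L_{2m}^{1/2}$, where the subscript $N$ or $D$ means that Neumann or Dirichlet boundary conditions are imposed on the two boundary arcs that issue from the pole, and the superscript $+$ or $-$ means that Neumann, respectively Dirichlet, boundary conditions are imposed on the equatorial boundary arc. Put $$\widetilde N_N^+(t)=\frac t{4m}+\Big(\frac14+\frac1{4m}\Big)\sqrt{t+\tfrac14}+\frac1{24}\Big(m-\frac1m\Big)+\frac18+\frac1{12m},$$ $$\widetilde N_N^-(t)=\frac t{4m}+\Big(\frac14-\frac1{4m}\Big)\sqrt{t+\tfrac14}+\frac1{24}\Big(m-\frac1m\Big)-\frac18+\frac1{12m},$$ $$\widetilde N_D^+(t)=\frac t{4m}+\Big(-\frac14+\frac1{4m}\Big)\sqrt{t+\tfrac14}+\frac1{24}\Big(m-\frac1m\Big)-\frac18+\frac1{12m},$$ $$\widetilde N_D^-(t)=\frac t{4m}+\Big(-\frac14-\frac1{4m}\Big)\sqrt{t+\tfrac14}+\frac1{24}\Big(m-\frac1m\Big)+\frac18+\frac1{12m}.$$ For each of the four boundary conditions, let $A(t)=\frac1t\int_0^t\big(N(s)-\widetilde N(s)\big)\,ds$ with the corresponding $N$ and $\widetilde N$. Then there exists a continuous periodic function $g$ of mean value zero such that $$A(t)=g\Big(\sqrt{t+\tfrac14}\Big)+O(t^{-1/2})\qquad\text{as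 } t\to\infty .$$
   Context: $S^2$ is the round 2-sphere of radius 1 in $\mathbb R^3$, with coordinates $(x,y,w)$, poles $(0,0,\pm1)$ and equator $\{w=0\}$. The lune $L_{2m}$ is the region of $S^2$ cut out by two great semicircles from pole to pole separated by the angle $\frac{2\pi}{2m}$; the half-lune is the part of $L_{2m}$ on one side of the equator, bounded by two quarter great circles from a pole and an arc of the equator of length $\pi/m$. The eigenvalue counting function of an operator with discrete spectrum $0\le\lambda_1\le\lambda_2\le\cdots\to\infty$ (repeated according to multiplicity) is $N(t)=\#\{j:\lambda_j\le t\}$. The mean value of a periodic function is its average over a period. *)

(* Defs.v *)
From HB Require Import structures.
From mathcomp Require Import all_boot all_order all_algebra.
From mathcomp Require Import all_classical all_reals all_analysis.
Set Implicit Arguments.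
Unset Strict Implicit.
Unset Printing Implicit Defensive.
Import Order.TTheory GRing.Theory Num.Theory.
Import numFieldNormedType.Exports.
Local Open Scope classical_set_scope.
Local Open Scope ring_scope.

Inductive bc : Type := Neumann | Dirichlet.

(* Meaningful for open [A] only. *)
Fixpoint Ck (R : realType) (V : normedModType R) (k : nat) (A : set V)
    (f : V -> R) : Prop :=
  if k is j.+1 then
    (forall p, A p -> differentiable f p) /\
    (forall v : V, Ck j A (fun p => 'D_v f p))
  else forall p, A p -> {for p, continuous f}.

Definition vec3 (R : realType) (x y w : R) : 'rV[R]_3 :=
  \row_(i < 3) nth 0 [:: x; y; w] i.

(* Polar angle [q.1] measured from the pole (0,0,1), longitude [q.2]. *)
Definition sph (R : realType) (q : R * R) : 'rV[R]_3 :=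
  vec3 (sin q.1 * cos q.2) (sin q.1 * sin q.2) (cos q.1).

Definition half_lune_chart (R : realType) (m : nat) : set (R * R) :=
  [set q | (0 <= q.1 <= pi / 2) /\ (0 <= q.2 <= pi / m%:R)].

Definition half_lune_chart_int (R : realType) (m : nat) : set (R * R) :=
  [set q | (0 < q.1 < pi / 2) /\ (0 < q.2 < pi / m%:R)].

Definition half_lune (R : realType) (m : nat) : set 'rV[R]_3 :=
  @sph R @` half_lune_chart m.

(* The Laplace-Beltrami operator of the round metric
   d theta^2 + sin(theta)^2 d phi^2, applied to a function [v] expressed in
   the coordinates (theta, phi); it is only used for 0 < theta < pi/2. *)
Definition laplace_beltrami (R : realType) (v : R * R -> R) (q : R * R) : R :=
  let d_theta (f : R * R -> R) := fun p => 'D_((1, 0) : R * R) f p in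
  let d_phi (f : R * R -> R) := fun p => 'D_((0, 1) : R * R) f p in
  (sin q.1)^-1 * d_theta (fun p => sin p.1 * d_theta v p) q
  + (sin q.1)^-2 * d_phi (d_phi v) q.

(* At the point [sph (theta, phi)]: unit vector tangent to the sphere and
   orthogonal to the meridian of longitude [phi]. *)
Definition meridian_normal (R : realType) (phi : R) : 'rV[R]_3 :=
  vec3 (- sin phi) (cos phi) 0.

(* Unit normal to the equator; tangent to the sphere at equatorial points. *)
Definition equator_normal (R : realType) : 'rV[R]_3 := vec3 0 0 1.

(* The condition [u = 0] or [d_n u = 0] at the point [p].  When [n] is tangent
   to the sphere at [p] and [u] is differentiable, it depends only on the
   restriction of [u] to the half-lune. *)
Definition bc_holds (R : realType) (b : bc) (n p : 'rV[R]_3)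
    (u : 'rV[R]_3 -> R) : Prop :=
  match b with
  | Neumann => 'D_n u p = 0
  | Dirichlet => u p = 0
  end.

(* Classical solutions of [- Delta u = l u]: C^2 in the open half-lune and C^1
   up to the boundary, corners included, with condition [b] on the two arcs
   issuing from the pole and condition [e] on the equatorial arc.  A function
   on the closed half-lune that is C^1 up to the boundary is represented by a
   C^1 extension to the whole space; only its values on the half-lune matter
   (see [lin_indep_on]). *)
Definition eigenfunction (R : realType) (m : nat) (b e : bc) (l : R)
    (u : 'rV[R]_3 -> R) : Prop :=
  [/\ Ck 1 setT u,
      Ck 2 (half_lune_chart_int m) (u \o @sph R),
      (forall q, half_lune_chart_int m q ->
         - laplace_beltrami (u \o @sph R) q = l * u (sph q)),
      (forall theta, 0 <= theta <= pi / 2 ->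
         bc_holds b (meridian_normal 0) (sph (theta, 0)) u /\
         bc_holds b (meridian_normal (pi / m%:R)) (sph (theta, pi / m%:R)) u) &
      (forall phi, 0 <= phi <= pi / m%:R ->
         bc_holds e (equator_normal R) (sph (pi / 2, phi)) u)].

Definition lin_indep_on (R : realType) (T : Type) (A : set T) (n : nat)
    (f : 'I_n -> T -> R) : Prop :=
  forall c : 'I_n -> R,
    (forall p, A p -> \sum_(i < n) c i * f i p = 0) -> forall i, c i = 0.

(* Dimension of the eigenspace, as functions on the half-lune: 0 if [l] is not
   an eigenvalue, +oo if the eigenspace is infinite dimensional. *)
Definition multiplicity (R : realType) (m : nat) (b e : bc) (l : R) : \bar R :=
  ereal_sup [set n%:R%:E | n in
    [set n : nat | exists f : 'I_n -> 'rV[R]_3 -> R,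
       (forall i, eigenfunction m b e l (f i)) /\
       lin_indep_on (half_lune m) f]].

(* The number of eigenvalues not exceeding [t], repeated according to
   multiplicity. *)
Definition counting (R : realType) (m : nat) (b e : bc) (t : R) : R :=
  fine (\esum_(l in [set l : R | l <= t]) multiplicity m b e l).

Definition counting_approx (R : realType) (m : nat) (b e : bc) (t : R) : R :=
  let M : R := m%:R in
  let s := Num.sqrt (t + 1 / 4) in
  match b, e with
  | Neumann, Neumann =>
      t / (4 * M) + (1 / 4 + 1 / (4 * M)) * s
      + 1 / 24 * (M - 1 / M) + 1 / 8 + 1 / (12 * M)
  | Neumann, Dirichlet =>
      t / (4 * M) + (1 / 4 - 1 / (4 * M)) * s
      + 1 / 24 * (M - 1 / M) - 1 / 8 + 1 / (12 * M)
  | Dirichlet, Neumann =>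
      t / (4 * M) + (- (1 / 4) + 1 / (4 * M)) * s
      + 1 / 24 * (M - 1 / M) - 1 / 8 + 1 / (12 * M)
  | Dirichlet, Dirichlet =>
      t / (4 * M) + (- (1 / 4) - 1 / (4 * M)) * s
      + 1 / 24 * (M - 1 / M) + 1 / 8 + 1 / (12 * M)
  end.

Definition average_error (R : realType) (m : nat) (b e : bc) (t : R) : R :=
  1 / t * \int[lebesgue_measure]_(s in `[0, t])
            (counting m b e s - counting_approx m b e s).

(* Main.v *)
Require Import Defs.
From mathcomp Require Import all_boot all_order all_algebra.
From mathcomp Require Import all_classical all_reals all_analysis.
From mathcomp Require Import ring lra zify.
Import Order.TTheory GRing.Theory Num.Theory.
Import numFieldNormedType.Exports.
Local Open Scope classical_set_scope.
Local Open Scope ring_scope.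

Set Implicit Arguments.
Unset Strict Implicit.
Unset Printing Implicit Defensive.

(** The variables separate in the polar angle [theta] and the longitude [phi].
    Each boundary condition on the meridians leaves the azimuthal factors
    [cos (m k phi)] (Neumann, [k >= 0]) or [sin (m k phi)] (Dirichlet, [k >= 1]);
    the polar factor is then [sin theta ^ (m k)] times a Gegenbauer polynomial
    in [cos theta], which the condition on the equator forces to be even
    (Neumann) or odd (Dirichlet).  Such a mode has degree
    [n = m k + r + 2 i], with [r = 0] or [1] the parity and [i >= 0], and
    eigenvalue [n (n + 1)].

    These modes give the whole spectrum with the right multiplicities.  The
    explicit functions are eigenfunctions ([mode_eigenfunction]) and modes with
    distinct [k] are independent ([modes_lin_indep]).  Conversely, by Green's
    formula an eigenfunction is orthogonal to every mode of another eigenvalue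
    ([eigenfunction_orthogonal]), and a continuous function orthogonal to all
    modes vanishes ([modes_complete]); hence the eigenspace of [l] is no larger
    than the number of modes of eigenvalue [l] ([lin_indep_le]).  Eigenfunctions
    are only assumed to be of class C^2 inside and C^1 up to the boundary, so
    Green's formula comes from a divergence theorem that needs derivatives in the
    open rectangle only ([divergence_rectangle]).  Completeness reduces to the
    moment problem for continuous functions on [0, 1] ([moments_eq0]), used in
    each of the two variables.

    With [s = sqrt (t + 1/4)], the condition [n (n + 1) <= t] reads
    [n + 1/2 <= s], so the integral of the counting function from 0 to [t] is the
    sum of [s^2 - (r + 1/2 + m k + 2 i)^2] over the lattice points [(k, i)] where
    this is nonnegative ([lattice_sum]).  Summing over [i] by Euler-Maclaurin gives a
    cubic polynomial in [s] and [a = r + 1/2 + m k], plus [s] times the periodic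
    Bernoulli function [beta (s - a)], up to a bounded error ([row_sumE]).
    Summing over [k], the cubics add up to the integral of [counting_approx] up to
    O(s) ([main_error_affine]).  As [beta] has period 2, [beta (s - a)] takes only
    two values, according to the parity of [k], and about [s / m] rows contribute:
    this gives the term [s^2 g(s)], where
    [g s = (beta (s - r - 1/2) + beta (s - r - 1/2 - m)) / (2 m)] is continuous,
    has period 2 and, like [beta], mean value zero ([lattice_sum_asymp]).
    Dividing by [t] gives the theorem. *)

(** * Integrals of continuous functions over the unit interval *)

Section ContinuityRules.
Context {R : realType} {T : topologicalType}.
Implicit Types f g : T -> R.

Lemma contD f g : continuous f -> continuous g -> continuous (fun x => f x + g x).
Proof. by move=> cf cg x; apply: cvgD; [exact: cf|exact: cg]. Qed.

Lemma contN f : continuous f -> continuous (fun x => - f x).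
Proof. by move=> cf x; apply: cvgN; exact: cf. Qed.

Lemma contB f g : continuous f -> continuous g -> continuous (fun x => f x - g x).
Proof. by move=> cf cg; apply: contD => //; exact: contN. Qed.

Lemma contM f g : continuous f -> continuous g -> continuous (fun x => f x * g x).
Proof. by move=> cf cg x; apply: cvgM; [exact: cf|exact: cg]. Qed.

Lemma cont_comp (U : topologicalType) (h : T -> U) (F : U -> R) :
  continuous F -> continuous h -> continuous (fun x => F (h x)).
Proof. by move=> cF ch x; apply: continuous_comp; [exact: ch|exact: cF]. Qed.

Lemma contX f n : continuous f -> continuous (fun x => f x ^+ n).
Proof.
by move=> cf; apply: (cont_comp (F := fun x : R => x ^+ n)) => //; exact: exprn_continuous.
Qed.

Lemma contC (U : topologicalType) (c : U) : continuous (fun _ : T => c).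
Proof. by move=> x; exact: cvg_cst. Qed.

Lemma cont_pair (U V : topologicalType) (h : T -> U) (k : T -> V) :
  continuous h -> continuous k -> continuous (fun x => (h x, k x)).
Proof. by move=> ch ck x; apply: cvg_pair; [exact: ch|exact: ck]. Qed.

Lemma cont_fst (U V : topologicalType) (h : T -> U * V) :
  continuous h -> continuous (fun x => (h x).1).
Proof. by move=> ch x; apply: continuous_comp; [exact: ch|exact: cvg_fst]. Qed.

Lemma cont_snd (U V : topologicalType) (h : T -> U * V) :
  continuous h -> continuous (fun x => (h x).2).
Proof. by move=> ch x; apply: continuous_comp; [exact: ch|exact: cvg_snd]. Qed.

Lemma cont_sin f : continuous f -> continuous (fun x => sin (f x)).
Proof. by move=> cf; apply: cont_comp => //; exact: continuous_sin. Qed.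

Lemma cont_cos f : continuous f -> continuous (fun x => cos (f x)).
Proof. by move=> cf; apply: cont_comp => //; exact: continuous_cos. Qed.

Lemma cont_horner (p : {poly R}) f :
  continuous f -> continuous (fun x => p.[f x]).
Proof. by move=> cf; apply: cont_comp => //; exact: continuous_horner. Qed.

Lemma cont_id : continuous (fun x : T => x).
Proof. by move=> x; exact: cvg_id. Qed.

Lemma cont_sum (I : Type) (s : seq I) (f : I -> T -> R) :
  (forall i, continuous (f i)) -> continuous (fun x => \sum_(i <- s) f i x).
Proof.
move=> cf; elim: s => [|i s IH] x; rewrite /continuous_at.
  by under eq_fun do rewrite big_nil; rewrite big_nil; exact: cvg_cst.
under eq_fun do rewrite big_cons; rewrite big_cons.
by apply: cvgD; [exact: cf|exact: IH].
Qed.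

End ContinuityRules.

(* The cases follow the syntax of the function: letting unification choose the
   rule would make it unfold definitions. *)
Ltac cont1 :=
  match goal with |- continuous ?F =>
    lazymatch F with
    | (fun _ => ?c) => exact: contC
    | (fun x => x) => exact: cont_id
    | (fun x => @GRing.add _ (@?f x) (@?g x)) => apply: (contD (f := f) (g := g))
    | (fun x => @GRing.opp _ (@?f x)) => apply: (contN (f := f))
    | (fun x => @GRing.mul _ (@?f x) (@?g x)) => apply: (contM (f := f) (g := g))
    | (fun x => @GRing.exp _ (@?f x) _) => apply: (contX (f := f))
    | (fun x => sin (@?f x)) => apply: (cont_sin (f := f))
    | (fun x => cos (@?f x)) => apply: (cont_cos (f := f))
    | (fun x => (@?f x, @?g x)) => apply: (cont_pair (h := f) (k := g))
    | (fun x => horner ?p (@?f x)) => apply: (cont_horner (f := f))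
    | (fun x => fst (@?h x)) => apply: (cont_fst (h := h))
    | (fun x => snd (@?h x)) => apply: (cont_snd (h := h))
    | (fun x => ?G (@?h x)) =>
        first [assumption | apply: (cont_comp (F := G) (h := h)); first assumption]
    | _ => assumption
    end
  end.
Ltac cont := repeat cont1.

Lemma is_derive_chain {R : realType} (F g : R -> R) (x a b : R) :
  is_derive (g x) 1 F a -> is_derive x 1 g b ->
  is_derive x 1 (fun y => F (g y)) (a * b).
Proof. exact: is_derive1_comp. Qed.

Section UnitIntegral.
Context {R : realType}.
Notation mu := (@lebesgue_measure R).
Implicit Types f g h : R -> R.

Definition int01 h : R := \int[mu]_(x in `[0, 1]) h x.

Lemma integrable01 h : continuous h -> mu.-integrable `[0, 1] (EFin \o h).
Proof.
move=> ch; apply: continuous_compact_integrable; first exact: segment_compact.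
exact: continuous_subspaceT.
Qed.

Lemma int01D f g : continuous f -> continuous g ->
  int01 (fun x => f x + g x) = int01 f + int01 g.
Proof. by move=> cf cg; rewrite /int01 RintegralD//; exact: integrable01. Qed.

Lemma int01B f g : continuous f -> continuous g ->
  int01 (fun x => f x - g x) = int01 f - int01 g.
Proof. by move=> cf cg; rewrite /int01 RintegralB//; exact: integrable01. Qed.

Lemma int01Z c f : continuous f -> int01 (fun x => c * f x) = c * int01 f.
Proof. by move=> cf; rewrite /int01 RintegralZl//; exact: integrable01. Qed.

Lemma eq_int01 f g : (forall x : R, 0 <= x <= 1 -> f x = g x) -> int01 f = int01 g.
Proof.
move=> fg; apply: eq_Rintegral => x; rewrite inE/= in_itv/=; exact: fg.
Qed.

Lemma int01_cst c : int01 (fun=> c) = c.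
Proof.
rewrite /int01 Rintegral_cst//= lebesgue_measure_itv/= lte_fin ltr01.
by rewrite oppr0 adde0 mulr1.
Qed.

Lemma le_int01 f g : continuous f -> continuous g ->
  (forall x : R, 0 <= x <= 1 -> f x <= g x) -> int01 f <= int01 g.
Proof.
move=> cf cg fg; apply: le_Rintegral; [by []|exact: integrable01|exact: integrable01|].
by move=> x /=; rewrite in_itv/=; exact: fg.
Qed.

Lemma norm_int01_le f M : continuous f ->
  (forall x : R, 0 <= x <= 1 -> `|f x| <= M) -> `|int01 f| <= M.
Proof.
move=> cf fM; rewrite -[M]int01_cst ler_norml; apply/andP; split.
  rewrite -mulN1r -int01Z; last exact: (contC (T := R)).
  apply: le_int01 => //; first by cont.
  by move=> x /fM; rewrite ler_norml mulN1r => /andP[].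
apply: le_int01 => //; first by cont.
by move=> x /fM; rewrite ler_norml => /andP[].
Qed.

Lemma Rintegral_FTC (F f : R -> R) (a b : R) : a < b -> continuous f ->
  (forall x, a <= x <= b -> {for x, continuous F}) ->
  (forall x : R, a < x < b -> is_derive x 1 F (f x)) ->
  \int[mu]_(x in `[a, b]) f x = F b - F a.
Proof.
move=> ab cf cF dF; rewrite /Rintegral (@continuous_FTC2 _ f F)//.
- exact: continuous_subspaceT.
- split; [|apply: cvg_at_right_filter; apply: cF; by rewrite lexx ltW
          |apply: cvg_at_left_filter; apply: cF; by rewrite lexx ltW].
  by move=> x; rewrite in_itv/= => /dF[].
- move=> x; rewrite in_itv/= => /dF dx; rewrite derive1E; exact: derive_val.
Qed.

Lemma int01_FTC (F f : R -> R) : continuous F -> continuous f ->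
  (forall x : R, 0 < x < 1 -> is_derive x 1 F (f x)) -> int01 f = F 1 - F 0.
Proof. by move=> cF cf; apply: Rintegral_FTC => // x _; exact: cF. Qed.

(** Compactness of [0, 1] makes the integrand uniformly close to its value at
    the parameter [x]. *)
Lemma cont_int01 (T : topologicalType) (F : T -> R -> R) :
  continuous (fun q : T * R => F q.1 q.2) -> continuous (fun x => int01 (F x)).
Proof.
move=> cF x; have cFx y : continuous (F y).
  apply: (cont_comp (F := fun q : T * R => F q.1 q.2) (h := fun t => (y, t)) cF).
  by cont.
apply/cvgrPdist_le => e e0.
have : \forall y \near x, `[0, 1] `<=` (fun t => `|F x t - F y t| <= e).
  have /compact_near_coveringP C01 := @segment_compact R 0 1.
  apply: C01 => t _.
  have ce := cF (x, t).
  have e20 : 0 < e / 2 by rewrite divr_gt0.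
  have := cvgr_dist_le _ _ ce _ e20.
  have := cvgr_dist_le _ _ (cFx x t) _ e20.
  rewrite /= => H1 [[U V] /= [Ux Vt]] UV.
  exists ([set t' | V t' /\ `|F x t - F x t'| <= e / 2], U) => /=.
    by split; [apply: filterI => //; exact: H1|exact: Ux].
  move=> [t' y] /= [[Vt' H3] Uy].
  have := UV (y, t') (conj Uy Vt') => /= H4.
  have -> : F x t' - F y t' = (F x t - F y t') - (F x t - F x t') by ring.
  rewrite (le_trans (ler_normB _ _))//; lra.
apply: filterS => y H.
rewrite -int01B//; apply: norm_int01_le; first exact: contB.
by move=> t t01; apply: (H t); rewrite /= in_itv.
Qed.

Lemma ex_antiderivative f : continuous f ->
  exists p : R -> R, forall x : R, -1 < x -> is_derive x 1 p (f x).
Proof.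
move=> cf; exists (fun x => \int[mu]_(t in `[-1, x]) f t) => x x1.
(* the base point -1 leaves room for two-sided derivatives on [0, 1] *)
case: (@continuous_FTC1 R f (BLeft (-1)) x (x + 1)).
- by rewrite ltrDl.
- apply: continuous_compact_integrable; first exact: segment_compact.
  exact: continuous_subspaceT.
- by have H : (BLeft (-1) < BRight x)%O by rewrite bnd_simp ltW.
- exact: cf.
- by move=> dF <-; rewrite derive1E; exact: derivableP.
Qed.

(** This replaces the additivity of integrals over intervals and the change of
    variables: every integral below is over the unit interval. *)
Lemma int01_shift (f p : R -> R) (a h : R) : continuous f ->
  (forall x : R, -1 < x -> is_derive x 1 p (f x)) -> -1 < a -> -1 < a + h ->
  p (a + h) - p a = int01 (fun s => h * f (a + h * s)).
Proof.
move=> cf dp a1 ah1.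
have itv (s : R) : 0 <= s <= 1 -> -1 < a + h * s.
  move=> /andP[s0 s1].
  have [->|sn0] := eqVneq s 0; first by rewrite mulr0 addr0.
  have : 0 <= (1 - s) * (a + 1) by rewrite mulr_ge0//; lra.
  have : 0 < s * (a + h + 1) by rewrite mulr_gt0// ?lt_neqAle 1?eq_sym ?sn0//; lra.
  lra.
have dps (s : R) : 0 <= s <= 1 -> is_derive s 1 (fun s => p (a + h * s)) (h * f (a + h * s)).
  move=> s01; have D1 := dp _ (itv s s01).
  have D2 : is_derive s 1 (fun s : R => a + h * s) h.
    by apply: is_derive_eq; rewrite add0r mul1r [_ *: _]mulr1.
  rewrite [h * f _]mulrC; exact: (is_derive_chain (g := fun s => a + h * s) D1 D2).
have -> : p (a + h) - p a = p (a + h * 1) - p (a + h * 0).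
  by rewrite mulr1 mulr0 addr0.
apply/esym; refine (Rintegral_FTC (F := fun s => p (a + h * s)) ltr01 _ _ _).
- by cont.
- move=> s s01; apply: differentiable_continuous; apply/derivable1_diffP.
  by case: (dps s s01).
- by move=> s /andP[s0 s1]; apply: dps; rewrite !ltW.
Qed.

(** Both iterated integrals are the increment from 0 to 1 of
    [x |-> int_y P(x, y)], where [P(., y)] is the antiderivative of [f(., y)]
    vanishing at 0.  Its derivative [int_y f(x, y)] is computed from continuity of
    integrals with respect to parameters, without product measures. *)
Lemma int01_Fubini (f : R -> R -> R) : continuous (fun q : R * R => f q.1 q.2) ->
  int01 (fun x => int01 (fun y => f x y)) = int01 (fun y => int01 (fun x => f x y)).
Proof.
move=> cf.
have cf1 y : continuous (f ^~ y).
  by apply: (cont_comp (h := fun x => (x, y)) cf); cont.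
pose P x y := int01 (fun s => x * f (x * s) y).
have cP : continuous (fun q : R * R => P q.1 q.2).
  apply: (cont_int01 (F := fun (q : R * R) s => q.1 * f (q.1 * s) q.2)) => /=.
  cont.
  by apply: (cont_comp (h := fun q : R * R * R => (q.1.1 * q.2, q.1.2)) cf); cont.
have cP2 x : continuous (P x).
  by apply: (cont_comp (h := fun y => (x, y)) cP); cont.
have PD (x h y : R) : -1 < x -> -1 < x + h ->
    P (x + h) y - P x y = h * int01 (fun s => f (x + h * s) y).
  move=> x1 xh1; have [p dp] := ex_antiderivative (cf1 y).
  have PE (z : R) : -1 < z -> P z y = p z - p 0.
    move=> z1; have := int01_shift (a := 0) (h := z) (cf1 y) dp.
    rewrite add0r => ->; rewrite ?ltrN10//.
    by apply: eq_int01 => s _; rewrite add0r.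
  rewrite !PE// opprB addrA subrK (int01_shift (cf1 y) dp)// int01Z//.
  by apply: (cont_comp (h := fun s => x + h * s) (cf1 y)); cont.
pose Q x := int01 (P x).
have dQ (x : R) : 0 < x < 1 -> is_derive x 1 Q (int01 (fun y => f x y)).
  move=> /andP[x0 x1].
  pose K (h : R) := int01 (fun y => int01 (fun s => f (x + h * s) y)).
  have cK : continuous K.
    apply: (cont_int01 (F := fun (h : R) y => int01 (fun s => f (x + h * s) y))).
    apply: (cont_int01 (F := fun (q : R * R) s => f (x + q.1 * s) q.2)) => /=.
    by apply: (cont_comp (h := fun q : R * R * R => (x + q.1.1 * q.2, q.1.2)) cf); cont.
  have K0 : K 0 = int01 (fun y => f x y).
    apply: eq_int01 => y _.
    by rewrite -[RHS]int01_cst; apply: eq_int01 => s _; rewrite mul0r addr0.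
  (* by [PD], the difference quotient is [K h] *)
  have lim : (fun h : R => h^-1 *: ((Q \o shift x) h - Q x)) @ 0^' --> K 0.
    apply: (cvg_trans (G := K @ 0^')); last first.
      by apply: cvg_within_filter; exact: cK.
    apply: near_eq_cvg.
    near=> h.
    have h0 : h != 0 by near: h; exact: nbhs_dnbhs_neq.
    have xh : -1 < x + h.
      have : `|h| < 1 by near: h; apply: dnbhs0_lt.
      by rewrite ltr_norml => /andP[h1 _]; rewrite -(addr0 (-1)) addrC ltrD.
    rewrite /= -int01B ?[h + x]addrC//.
    rewrite (@eq_int01 _ (fun y => h * int01 (fun s => f (x + h * s) y))).
      rewrite int01Z ?scalerA ?mulVf ?scale1r//.
      apply: (cont_int01 (F := fun y s => f (x + h * s) y)).
      by apply: (cont_comp (h := fun q : R * R => (x + h * q.2, q.1)) cf); cont.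
    by move=> y _; rewrite PD// (lt_trans _ x0)// ltrN10.
  rewrite K0 in lim.
  apply: DeriveDef; first by apply/cvg_ex; eexists; under eq_fun do rewrite [_ *: 1]mulr1; exact: lim.
  by rewrite /derive; under eq_fun do rewrite [_ *: 1]mulr1; apply: cvg_lim.
have -> := int01_FTC _ _ dQ.
- rewrite -int01B; [|exact: cP2|exact: cP2]; apply: eq_int01 => y _.
  rewrite -[X in P X](add0r 1) PD ?add0r ?ltrN10// ?mul1r.
    by apply: eq_int01 => x _; rewrite add0r mul1r.
- exact: (cont_int01 (F := P) cP).
- exact: (cont_int01 (F := f) cf).
Unshelve. all: by end_near.
Qed.

Lemma bounded01 h : continuous h ->
  exists2 M : R, 0 < M & forall x : R, 0 <= x <= 1 -> `|h x| <= M.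
Proof.
move=> ch.
have cn : {within `[0, 1], continuous (fun x => `|h x|)}.
  apply: continuous_subspaceT => x.
  by apply: (continuous_comp (f := h)); [exact: ch|exact: norm_continuous].
have [c _ Hc] := EVT_max ler01 cn.
exists (`|h c| + 1); first by rewrite ltr_wpDl.
move=> x x01; apply: (le_trans (Hc x _)); first by rewrite in_itv.
by rewrite lerDl.
Qed.

Lemma int01_gt0 (w : R -> R) (x0 : R) : continuous w -> (forall x, 0 <= w x) -> 0 <= x0 <= 1 ->
  0 < w x0 -> 0 < int01 w.
Proof.
move=> cw w0 /andP[x00 x01] wx0.
have [d d0 Hd] : exists2 d, 0 < d & forall x, `|x - x0| < d -> w x0 / 2 <= w x.
  have e0 : 0 < w x0 / 2 by rewrite divr_gt0.
  have : \forall x \near x0, `|w x0 - w x| <= w x0 / 2.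
    exact: (cvgr_dist_le _ _ (cw x0) _ e0).
  move=> /nbhs_ballP[d /= d0 Hd].
  exists d => // x xd; have := Hd x; rewrite /ball/= distrC => /(_ xd).
  rewrite ler_norml; lra.
(* [u, v] is the part in [0, 1] of an interval about [x0] where [w] is large *)
pose u := Num.max 0 (x0 - d / 2); pose v := Num.min 1 (x0 + d / 2).
have u0 : 0 <= u by rewrite /u le_max lexx.
have v1 : v <= 1 by rewrite /v ge_min lexx.
have ux : x0 - d / 2 <= u by rewrite /u le_max lexx orbT.
have vx : v <= x0 + d / 2 by rewrite /v ge_min lexx orbT.
have uv : u < v.
  by rewrite /u /v gt_max !lt_min ltr01/=; apply/andP; split; [|apply/andP; split]; lra.
have [p dp] := ex_antiderivative cw.
have ge (a' h' : R) : 0 <= a' -> 0 <= h' -> 0 <= p (a' + h') - p a'.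
  move=> a0 h0; rewrite (int01_shift cw dp); try lra.
  by apply: Rintegral_ge0 => s _; rewrite mulr_ge0.
have mid : (v - u) * (w x0 / 2) <= p (u + (v - u)) - p u.
  rewrite (int01_shift cw dp); try lra.
  rewrite -[leLHS]int01_cst; apply: le_int01; [by cont|by cont|].
  move=> s /andP[s0 s1]; rewrite ler_wpM2l//; first lra.
  by apply: Hd; rewrite ltr_norml; apply/andP; split; nra.
have := int01_shift (a := 0) (h := 1) cw dp.
rewrite (@eq_int01 _ w); last by move=> s _; rewrite add0r !mul1r.
move=> <-; try lra.
have := ge 0 u (lexx _) u0; have := ge v (1 - v) ltac:(lra) ltac:(lra).
have : 0 < (v - u) * (w x0 / 2) by rewrite mulr_gt0// ?divr_gt0//; lra.
by move: mid; rewrite !subrKC !add0r; lra.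
Qed.

End UnitIntegral.

(** * The moment problem *)

Section Moments.
Context {R : realType}.
Implicit Types h X : R -> R.

Lemma bernoulli_ineq (y : R) n : 1 <= y -> n%:R * (y - 1) <= y ^+ n.
Proof.
move=> y1; suff : 1 + n%:R * (y - 1) <= y ^+ n by lra.
elim: n => [|n IH]; first by rewrite mul0r addr0 expr0.
rewrite exprS -natr1.
have : y * (1 + n%:R * (y - 1)) <= y * y ^+ n by rewrite ler_wpM2l//; lra.
have n0 : 0 <= n%:R * (y - 1) ^+ 2 by rewrite mulr_ge0// ?ler0n ?sqr_ge0.
rewrite expr2 in n0; nra.
Qed.

(** If [h x0 > 0], take a polynomial [P] in [X] that exceeds 1 only near [x0],
    where [h] is bounded below, and lies in [0, 1] elsewhere: the integral of
    [h * P ^ n] tends to infinity with [n] instead of being 0. *)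
Lemma moments_le0 X h (x0 : R) : continuous X -> continuous h ->
  (forall x y : R, 0 <= x <= 1 -> 0 <= y <= 1 -> X x = X y -> x = y) ->
  (forall q : {poly R}, int01 (fun x => h x * q.[X x]) = 0) ->
  0 <= x0 <= 1 -> h x0 <= 0.
Proof.
move=> cX ch injX hq x01; rewrite leNgt; apply/negP => hx0.
pose D x := (X x - X x0) ^+ 2.
have cD : continuous D by rewrite /D; cont.
have D0 x : 0 <= D x by exact: sqr_ge0.
(* [h] is large wherever [X] is close to [X x0], because [X] is injective *)
have [eta eta0 Heta] : exists2 e : R, 0 < e &
    forall x : R, 0 <= x <= 1 -> D x < e -> h x0 / 2 <= h x.
  pose K := `[0, 1] `&` [set x | h x <= h x0 / 2].
  have [K0|/set0P[k Kk]] := eqVneq K set0.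
    exists 1 => // x xx _; rewrite leNgt; apply/negP => hx.
    suff : K x by rewrite K0.
    by split; [rewrite /= in_itv|exact: ltW].
  have cK : compact K.
    rewrite /K; apply: compact_closedI; first exact: segment_compact.
    rewrite (_ : [set x | _] = h @^-1` [set y | y <= h x0 / 2])//.
    apply: closed_comp; last exact: closed_le.
    by move=> x _; exact: ch.
  have [] := @compact_EVT_min R R D K _ cK; first by exists k.
    exact: continuous_subspaceT.
  move=> c; rewrite inE => -[c01 hc] Hc.
  rewrite /= in_itv/= in c01.
  exists (D c).
    rewrite lt_neqAle D0 andbT eq_sym sqrf_eq0 subr_eq0; apply/eqP => /(injX _ _ c01 x01) cx.
    by move: hc; rewrite /= cx; lra.
  move=> x xx Dx; rewrite leNgt; apply/negP => hx.
  have : D c <= D x by apply: Hc; rewrite inE; split; [rewrite /= in_itv|exact: ltW].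
  by rewrite leNgt Dx.
have [B B0 HB] := bounded01 cD.
have [M M0 HM] := bounded01 ch.
pose P : {poly R} := (1 + eta / B)%:P - B^-1 *: ('X - (X x0)%:P) ^+ 2.
have PE x : P.[X x] = 1 + (eta - D x) / B.
  by rewrite /P !hornerE/= /D; ring.
pose w x := Num.max 0 (P.[X x] - 1).
have cw : continuous w.
  move=> x; apply: (@continuous_max R R (fun=> 0) (fun x => P.[X x] - 1)).
    exact: cvg_cst.
  by have cP : continuous (fun x => P.[X x] - 1); [cont|exact: cP].
have wpos : 0 < int01 w.
  apply: (@int01_gt0 _ w x0) => //; first by move=> x; rewrite le_max lexx.
  by rewrite /w PE /D subrr expr0n/= subr0 addrC addKr lt_max divr_gt0 ?orbT.
have key n : h x0 / 2 * n%:R * int01 w <= M.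
  rewrite -[leRHS]add0r -(hq (P ^+ n)) -[X in _ + X]int01_cst.
  rewrite -int01Z// -int01D; [|by cont|exact: (contC (T := R))].
  apply: le_int01; [by cont|by cont|] => x xx.
  rewrite horner_exp; have [P1|P1] := lerP P.[X x] 1.
    rewrite /w (max_idPl _) ?subr_le0// mulr0.
    have P0 : 0 <= P.[X x].
      have /ler_normlP[_ HBx] := HB _ xx.
      rewrite PE mulrBl; have : D x / B <= 1 by rewrite ler_pdivrMr// mul1r.
      have : 0 < eta / B by rewrite divr_gt0.
      lra.
    have Pn0 : 0 <= P.[X x] ^+ n by rewrite exprn_ge0.
    have Pn1 : P.[X x] ^+ n <= 1 by rewrite exprn_ile1.
    have := HM _ xx; rewrite ler_norml => /andP[hM _].
    nra.
  rewrite /w (max_idPr _); last by rewrite subr_ge0 ltW.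
  have hx : h x0 / 2 <= h x.
    apply: Heta => //; move: P1; rewrite PE ltrDl pmulr_lgt0 ?invr_gt0//.
    by rewrite subr_gt0.
  have := bernoulli_ineq n (ltW P1).
  set y := P.[X x] ^+ n; set z := n%:R * _ => zy.
  have z0 : 0 <= z by rewrite mulr_ge0// ?ler0n ?subr_ge0 ?ltW.
  by rewrite -mulrA -/z; nra.
have c0 : 0 < h x0 / 2 * int01 w by rewrite mulr_gt0 ?divr_gt0.
have [n Hn] : exists n : nat, M / (h x0 / 2 * int01 w) < n%:R.
  exists (Num.truncn (M / (h x0 / 2 * int01 w))).+1; exact: truncnS_gt.
have := key n; rewrite leNgt => /negP; apply.
by rewrite mulrAC mulrC -ltr_pdivrMr.
Qed.

(** Uniqueness in the Hausdorff moment problem, in the coordinate [X]. *)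
Lemma moments_eq0 X h (x0 : R) : continuous X -> continuous h ->
  (forall x y : R, 0 <= x <= 1 -> 0 <= y <= 1 -> X x = X y -> x = y) ->
  (forall q : {poly R}, int01 (fun x => h x * q.[X x]) = 0) ->
  0 <= x0 <= 1 -> h x0 = 0.
Proof.
move=> cX ch iX hq x01; apply/eqP; rewrite eq_le (moments_le0 cX ch)//=.
rewrite -oppr_le0 (@moments_le0 X (fun x => - h x))//; first by cont.
move=> q; under [LHS]eq_int01 => x _ do rewrite mulNr -mulN1r.
by rewrite int01Z ?hq ?mulr0//; cont.
Qed.

End Moments.

(** * The divergence theorem on a rectangle *)

Section Divergence.
Context {R : realType}.

Definition clamp01 (s : R) : R := Num.max 0 (Num.min 1 s).

Lemma clamp01_itv s : 0 <= clamp01 s <= 1.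
Proof. by rewrite /clamp01 le_max lexx/= ge_max ler01 ge_min lexx. Qed.

Lemma clamp01E s : 0 <= s <= 1 -> clamp01 s = s.
Proof. by move=> /andP[s0 s1]; rewrite /clamp01 (min_idPr s1) (max_idPr s0). Qed.

Lemma cont_clamp01 : continuous clamp01.
Proof.
move=> s; apply: (@continuous_max R R (fun=> 0) (fun s => Num.min 1 s)).
  exact: cvg_cst.
by apply: (@continuous_min R R (fun=> 1) id); [exact: cvg_cst|exact: cvg_id].
Qed.

(** The theorem for the field [(Xi, Ups)], of divergence [f], with zero flux
    through the boundary.  The partial derivatives exist in the open rectangle
    only and may be unbounded: the identity is proved on the rectangle shrunk by
    [t] on each side, where both members are continuous in [t], and [t] tends
    to 0. *)
Lemma divergence_rectangle (a b : R) (Xi Ups f dUps : R * R -> R) :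
  0 < a -> 0 < b -> continuous Xi -> continuous Ups -> continuous f ->
  (forall q : R * R, 0 < q.1 < a -> 0 < q.2 < b ->
    [/\ is_derive q.1 1 (fun x => Xi (x, q.2)) (f q - dUps q),
        is_derive q.2 1 (fun y => Ups (q.1, y)) (dUps q) &
        {for q, continuous dUps}]) ->
  (forall y, 0 <= y <= b -> Xi (0, y) = 0 /\ Xi (a, y) = 0) ->
  (forall x, 0 <= x <= a -> Ups (x, 0) = 0 /\ Ups (x, b) = 0) ->
  int01 (fun x => int01 (fun y => f (a * x, b * y))) = 0.
Proof.
move=> a0 b0 cXi cUps cf dXU Xi0 Ups0.
pose ea (t x : R) := t + (a - 2 * t) * x.
pose eb (t y : R) := t + (b - 2 * t) * y.
pose L t := (a - 2 * t) * (b - 2 * t) *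
   int01 (fun x => int01 (fun y => f (ea t x, eb t y))).
pose B t := (b - 2 * t) * int01 (fun y => Xi (ea t 1, eb t y) - Xi (ea t 0, eb t y))
   + (a - 2 * t) * int01 (fun x => Ups (ea t x, eb t 1) - Ups (ea t x, eb t 0)).
have cea : continuous (fun q : R * R => ea q.1 q.2) by rewrite /ea; cont.
have ceb : continuous (fun q : R * R => eb q.1 q.2) by rewrite /eb; cont.
have cL : continuous L.
  rewrite /L; cont.
  apply: (cont_int01 (F := fun t x => int01 (fun y => f (ea t x, eb t y)))).
  apply: (cont_int01 (F := fun (q : R * R) y => f (ea q.1 q.2, eb q.1 y))).
  by rewrite /ea /eb; cont.
have cB : continuous B.
  rewrite /B; cont.
    apply: (cont_int01 (F := fun t y => Xi (ea t 1, eb t y) - Xi (ea t 0, eb t y))).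
    by rewrite /ea /eb; cont.
  apply: (cont_int01 (F := fun t x => Ups (ea t x, eb t 1) - Ups (ea t x, eb t 0))).
  by rewrite /ea /eb; cont.
have main t : 0 < t -> t < a / 2 -> t < b / 2 -> L t = B t.
  move=> t0 ta tb.
  have ina x : 0 <= x <= 1 -> 0 < ea t x < a.
    by move=> /andP[x0 x1]; rewrite /ea; apply/andP; split; nra.
  have inb y : 0 <= y <= 1 -> 0 < eb t y < b.
    by move=> /andP[y0 y1]; rewrite /eb; apply/andP; split; nra.
  (* clamping makes the derivative continuous on the whole plane *)
  pose D x y := dUps (ea t (clamp01 x), eb t (clamp01 y)).
  pose g x y := f (ea t x, eb t y) - D x y.
  have cD : continuous (fun q : R * R => D q.1 q.2).
    move=> q.
    apply: (continuous_comp (f := fun q : R * R => (ea t (clamp01 q.1), eb t (clamp01 q.2)))).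
      have cc := cont_clamp01; suff cq : continuous
        (fun q : R * R => (ea t (clamp01 q.1), eb t (clamp01 q.2))) by exact: cq.
      by rewrite /ea /eb; cont.
    by case: (dXU (ea t (clamp01 q.1), eb t (clamp01 q.2)));
      rewrite /= ?ina ?inb ?clamp01_itv.
  have cfe : continuous (fun q : R * R => f (ea t q.1, eb t q.2)).
    by rewrite /ea /eb; cont.
  have cg : continuous (fun q : R * R => g q.1 q.2) by apply: contB.
  have cD1 y : continuous (D ^~ y).
    by apply: (cont_comp (h := fun x => (x, y)) cD); cont.
  have cD2 x : continuous (D x).
    by apply: (cont_comp (h := fun y => (x, y)) cD); cont.
  have cg1 y : continuous (g ^~ y).
    by apply: (cont_comp (h := fun x => (x, y)) cg); cont.
  have cg2 x : continuous (g x).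
    by apply: (cont_comp (h := fun y => (x, y)) cg); cont.
  have cig : continuous (fun x => int01 (g x)) by exact: (cont_int01 (F := g)).
  have ciD : continuous (fun x => int01 (D x)) by exact: (cont_int01 (F := D)).
  have chain (c d s dP : R) (P : R -> R) : is_derive (c + d * s) 1 P dP ->
      is_derive s 1 (fun s => P (c + d * s)) (d * dP).
    move=> HP; rewrite mulrC; apply: (is_derive_chain (g := fun s => c + d * s) HP).
    by apply: is_derive_eq; rewrite add0r mul1r [_ *: _]mulr1.
  have EX y : 0 <= y <= 1 -> (a - 2 * t) * int01 (g ^~ y) =
      Xi (ea t 1, eb t y) - Xi (ea t 0, eb t y).
    move=> yy; rewrite -int01Z//.
    apply: (int01_FTC (F := fun x => Xi (ea t x, eb t y))).
    - by rewrite /ea; cont.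
    - by have H := cg1 y; cont.
    - move=> x /andP[x0 x1]; have xx : 0 <= x <= 1 by rewrite !ltW.
      rewrite /g /D !clamp01E//; apply: (chain _ _ _ _ (fun x => Xi (x, eb t y))).
      by case: (dXU (ea t x, eb t y)); rewrite /= ?ina ?inb.
  have EY x : 0 <= x <= 1 -> (b - 2 * t) * int01 (D x) =
      Ups (ea t x, eb t 1) - Ups (ea t x, eb t 0).
    move=> xx; rewrite -int01Z//.
    apply: (int01_FTC (F := fun y => Ups (ea t x, eb t y))).
    - by rewrite /eb; cont.
    - by have H := cD2 x; cont.
    - move=> y /andP[y0 y1]; have yy : 0 <= y <= 1 by rewrite !ltW.
      rewrite /D !clamp01E//; apply: (chain _ _ _ _ (fun y => Ups (ea t x, y))).
      by case: (dXU (ea t x, eb t y)); rewrite /= ?ina ?inb.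
  rewrite /L /B -(eq_int01 EX) -(eq_int01 EY) !int01Z//; last first.
    by apply: (cont_int01 (F := fun y x => g x y));
       apply: (cont_comp (h := fun q : R * R => (q.2, q.1)) cg); cont.
  rewrite -(int01_Fubini cg).
  rewrite (@eq_int01 _ _ (fun x => int01 (g x) + int01 (D x))).
    by rewrite int01D//; ring.
  move=> x _; rewrite -int01D//; apply: eq_int01 => y _.
  by rewrite /g subrK.
have L0 : L 0 = B 0.
  have cLB : continuous (fun t => L t - B t) by cont.
  apply/eqP; rewrite -subr_eq0; apply/eqP.
  have H1 : (fun t => L t - B t) @ 0^'+ --> L 0 - B 0.
    by apply: cvg_at_right_filter; exact: cLB.
  have H2 : (fun t => L t - B t) @ 0^'+ --> (0 : R).
    apply: (cvg_trans (G := (fun=> 0) @ 0^'+)); last exact: cvg_cst.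
    apply: near_eq_cvg; near=> t.
    rewrite main ?subrr//.
      by near: t; apply: nbhs_right_lt; rewrite divr_gt0.
    by near: t; apply: nbhs_right_lt; rewrite divr_gt0.
  exact: (cvg_unique _ H1 H2).
have eaE x : ea 0 x = a * x by rewrite /ea mulr0 subr0 add0r.
have ebE x : eb 0 x = b * x by rewrite /eb mulr0 subr0 add0r.
have : B 0 = 0.
  rewrite /B (@eq_int01 _ _ (fun=> 0)); last first.
    move=> y /andP[y0 y1]; rewrite !eaE ebE mulr1 mulr0.
    have /Xi0[-> ->] : 0 <= b * y <= b by apply/andP; split; nra.
    by rewrite subrr.
  rewrite (@eq_int01 _ (fun x => Ups _ - Ups _) (fun=> 0)); last first.
    move=> x /andP[x0 x1]; rewrite !ebE eaE mulr1 mulr0.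
    have /Ups0[-> ->] : 0 <= a * x <= a by apply/andP; split; nra.
    by rewrite subrr.
  by rewrite int01_cst !mulr0 addr0.
rewrite -L0 /L !mulr0 !subr0 => /eqP; rewrite !mulf_eq0 (gt_eqF a0) (gt_eqF b0)/= => /eqP <-.
by apply: eq_int01 => x _; apply: eq_int01 => y _; rewrite eaE ebE.
Unshelve. all: by end_near.
Qed.

End Divergence.

(** * Calculus on the sphere *)

Section Calculus.
Context {R : realType}.
Implicit Types u : 'rV[R]_3 -> R.

Lemma vec3_lin (x y w : R) :
  vec3 x y w = x *: vec3 1 0 0 + y *: vec3 0 1 0 + w *: vec3 0 0 1.
Proof.
apply/rowP => i; rewrite !mxE.
case: i => -[|[|[|n]]] i3 /=; [ring|ring|ring|discriminate i3].
Qed.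

Lemma cont_vec3 (T : topologicalType) (f g h : T -> R) :
  continuous f -> continuous g -> continuous h ->
  continuous (fun t => vec3 (f t) (g t) (h t)).
Proof.
move=> cf cg ch t; rewrite /continuous_at vec3_lin.
under eq_fun do rewrite vec3_lin.
by apply: cvgD; [apply: cvgD|]; apply: cvgZl; [exact: cf|exact: cg|exact: ch].
Qed.

Lemma is_derive_vec3 (f g h : R -> R) (x f' g' h' : R) :
  is_derive x 1 f f' -> is_derive x 1 g g' -> is_derive x 1 h h' ->
  is_derive x 1 (fun t => vec3 (f t) (g t) (h t)) (vec3 f' g' h').
Proof.
move=> [df <-] [dg <-] [dh <-].
have D : derivable (fun t => vec3 (f t) (g t) (h t)) x 1.
  apply/derivable_mxP => i [[|[|[|n]]] j3]; last by discriminate j3.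
  - suff <- : f = (fun t => vec3 (f t) (g t) (h t) i (Ordinal j3)) by exact: df.
    by apply/funext => t; rewrite mxE.
  - suff <- : g = (fun t => vec3 (f t) (g t) (h t) i (Ordinal j3)) by exact: dg.
    by apply/funext => t; rewrite mxE.
  - suff <- : h = (fun t => vec3 (f t) (g t) (h t) i (Ordinal j3)) by exact: dh.
    by apply/funext => t; rewrite mxE.
apply: DeriveDef => //; rewrite derive_mx//; apply/rowP => -[[|[|[|n]]] j3];
  last by discriminate j3.
- by rewrite !mxE (_ : (fun t => _) = f)//; apply/funext => t; rewrite mxE.
- by rewrite !mxE (_ : (fun t => _) = g)//; apply/funext => t; rewrite mxE.
- by rewrite !mxE (_ : (fun t => _) = h)//; apply/funext => t; rewrite mxE.
Qed.

Lemma derive_vec3 u p (a b c : R) : differentiable u p ->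
  'D_(vec3 a b c) u p =
  a * 'D_(vec3 1 0 0) u p + b * 'D_(vec3 0 1 0) u p + c * 'D_(vec3 0 0 1) u p.
Proof. by move=> du; rewrite !deriveE// {1}vec3_lin !linearD !linearZ. Qed.

Lemma is_derive_curve u (gam : R -> 'rV[R]_3) (x : R) (gam' : 'rV[R]_3) :
  is_derive x 1 gam gam' -> differentiable u (gam x) ->
  is_derive x 1 (fun t => u (gam t)) ('D_gam' u (gam x)).
Proof.
move=> [dg <-] du.
have dg' : differentiable gam x by apply/derivable1_diffP.
have D : differentiable (u \o gam) x by exact: differentiable_comp.
apply: DeriveDef; first exact: diff_derivable.
by rewrite (deriveE _ D) diff_comp// (deriveE _ du) (deriveE _ dg').
Qed.

Lemma is_derive_fst (F : R * R -> R) (q : R * R) (d : R) :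
  is_derive q ((1, 0) : R * R) F d <-> is_derive q.1 1 (fun x => F (x, q.2)) d.
Proof.
have E : (fun h : R => h^-1 *: (F (h *: ((1, 0) : R * R) + q) - F q)) =
         (fun h : R => h^-1 *: (F (h *: 1 + q.1, q.2) - F (q.1, q.2))).
  apply/funext => h; rewrite -surjective_pairing; congr (_ *: (F _ - _)).
  by case: q => q1 q2; congr (_, _); rewrite /= ?[_ *: 0]mulr0 ?add0r.
by split=> -[]; rewrite /derivable /derive /= => D <-; apply: DeriveDef;
  rewrite /derivable /derive /= ?E// -?E.
Qed.

Lemma is_derive_snd (F : R * R -> R) (q : R * R) (d : R) :
  is_derive q ((0, 1) : R * R) F d <-> is_derive q.2 1 (fun y => F (q.1, y)) d.
Proof.
have E : (fun h : R => h^-1 *: (F (h *: ((0, 1) : R * R) + q) - F q)) =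
         (fun h : R => h^-1 *: (F (q.1, h *: 1 + q.2) - F (q.1, q.2))).
  apply/funext => h; rewrite -surjective_pairing; congr (_ *: (F _ - _)).
  by case: q => q1 q2; congr (_, _); rewrite /= ?[_ *: 0]mulr0 ?add0r.
by split=> -[]; rewrite /derivable /derive /= => D <-; apply: DeriveDef;
  rewrite /derivable /derive /= ?E// -?E.
Qed.

Lemma cont_sph : continuous (@sph R).
Proof. by rewrite /sph; apply: cont_vec3; cont. Qed.

(** The derivative of [sph] in the polar angle; its derivative in the longitude is
    [sin q.1 *: meridian_normal q.2]. *)
Definition sph_theta (q : R * R) : 'rV[R]_3 :=
  vec3 (cos q.1 * cos q.2) (cos q.1 * sin q.2) (- sin q.1).

Section C1.
Variable u : 'rV[R]_3 -> R.
Hypothesis du : forall p, differentiable u p.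

Lemma is_derive_sph_theta (q : R * R) :
  is_derive q ((1, 0) : R * R) (u \o @sph R) ('D_(sph_theta q) u (sph q)).
Proof.
apply/is_derive_fst; apply: (is_derive_curve (gam := fun x => sph (x, q.2))).
  rewrite /sph /sph_theta /=; apply: is_derive_vec3.
  - by apply: is_derive_eq; rewrite /GRing.scale/=; ring.
  - by apply: is_derive_eq; rewrite /GRing.scale/=; ring.
by rewrite -surjective_pairing.
Qed.

Lemma is_derive_sph_phi (q : R * R) :
  is_derive q ((0, 1) : R * R) (u \o @sph R)
    (sin q.1 * 'D_(meridian_normal q.2) u (sph q)).
Proof.
have -> : sin q.1 * 'D_(meridian_normal q.2) u (sph q) =
    'D_(vec3 (- (sin q.1 * sin q.2)) (sin q.1 * cos q.2) 0) u (sph q).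
  rewrite /meridian_normal.
  rewrite [in LHS](derive_vec3 _ _ _ (du _)) [in RHS](derive_vec3 _ _ _ (du _)).
  move: ('D_(vec3 1 0 0) u _) ('D_(vec3 0 1 0) u _) ('D_(vec3 0 0 1) u _) => x y w.
  ring.
apply/is_derive_snd; apply: (is_derive_curve (gam := fun y => sph (q.1, y))).
  rewrite /sph /=; apply: is_derive_vec3.
  by apply: is_derive_eq; rewrite /GRing.scale/=; ring.
by rewrite -surjective_pairing.
Qed.

Hypothesis cdu : forall v : 'rV[R]_3, continuous (fun p => 'D_v u p).

Lemma cont_derive_vec3 (T : topologicalType) (p : T -> 'rV[R]_3) (f g h : T -> R) :
  continuous p -> continuous f -> continuous g -> continuous h ->
  continuous (fun t => 'D_(vec3 (f t) (g t) (h t)) u (p t)).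
Proof.
move=> cp cf cg ch; under eq_fun do rewrite derive_vec3//.
by apply: contD; [apply: contD|]; apply: contM => //;
  apply: (cont_comp (F := fun p => 'D_(_) u p) (h := p)).
Qed.

Lemma cont_C1_sph : continuous (u \o @sph R).
Proof.
apply: (cont_comp (F := u)); last exact: cont_sph.
by move=> p; apply: differentiable_continuous; exact: du.
Qed.

Lemma cont_sph_theta : continuous (fun q => 'D_((1, 0) : R * R) (u \o @sph R) q).
Proof.
rewrite (_ : (fun q => _) = (fun q => 'D_(sph_theta q) u (sph q))); last first.
  by apply/funext => q; have [_ ->] := is_derive_sph_theta q.
by apply: cont_derive_vec3; [exact: cont_sph|cont..].
Qed.

Lemma cont_sph_normal :
  continuous (fun q : R * R => 'D_(meridian_normal q.2) u (sph q)).
Proof. by apply: cont_derive_vec3; [exact: cont_sph|cont..]. Qed.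

End C1.
End Calculus.

(** * Separated modes and the Green identity *)

Section Modes.
Context {R : realType}.
Implicit Types (p : {poly R}) (k : nat) (b e : bc).

(** The azimuthal factor of a mode; [azim'] is its derivative. *)
Definition azim b k (phi : R) : R :=
  if b is Neumann then cos (k%:R * phi) else sin (k%:R * phi).
Definition azim' b k (phi : R) : R :=
  k%:R * (if b is Neumann then - sin (k%:R * phi) else cos (k%:R * phi)).

(** The polar factor of a mode.  [spolar'] is [sin theta] times its derivative:
    the combination that enters the Laplacian, and without singularity at the
    pole. *)
Definition polar k p (theta : R) : R := sin theta ^+ k * p.[cos theta].
Definition spolar' k p (theta : R) : R :=
  k%:R * sin theta ^+ k * cos theta * p.[cos theta]
  - sin theta ^+ k.+2 * p^`().[cos theta].

(** Gegenbauer's equation: what remains of the associated Legendre equation after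
    factoring out [sin theta ^+ k]. *)
Definition gegenbauer k (lam : R) p := forall z : R,
  (1 - z ^+ 2) * p^`()^`().[z] - 2 * k.+1%:R * z * p^`().[z]
  + (lam - k%:R * k.+1%:R) * p.[z] = 0.

(** The condition on the equator for the polar factor, as [z = cos theta] vanishes
    there. *)
Definition equator_bc e p : Prop :=
  if e is Neumann then p^`().[0] = 0 else p.[0] = 0.

Lemma is_derive_azim b k (phi : R) : is_derive phi 1 (azim b k) (azim' b k phi).
Proof.
case: b; rewrite /azim /azim'.
  have D := is_derive_cos (k%:R * phi).
  have D1 : is_derive phi 1 (fun x : R => k%:R * x) k%:R.
    by apply: is_derive_eq; rewrite /GRing.scale/=; ring.
  by rewrite mulrC; exact: (is_derive_chain (g := fun x : R => k%:R * x) D D1).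
have D := is_derive_sin (k%:R * phi).
have D1 : is_derive phi 1 (fun x : R => k%:R * x) k%:R.
  by apply: is_derive_eq; rewrite /GRing.scale/=; ring.
by rewrite mulrC; exact: (is_derive_chain (g := fun x : R => k%:R * x) D D1).
Qed.

Lemma is_derive_azim' b k (phi : R) :
  is_derive phi 1 (azim' b k) (- k%:R ^+ 2 * azim b k phi).
Proof.
have D1 : is_derive phi 1 (fun x : R => k%:R * x) k%:R.
  by apply: is_derive_eq; rewrite /GRing.scale/=; ring.
case: b; rewrite /azim /azim'.
  have D := is_derive_sin (k%:R * phi).
  have := is_derive_chain (g := fun x : R => k%:R * x) D D1 => D2.
  by apply: is_derive_eq; rewrite /GRing.scale/=; ring.
have D := is_derive_cos (k%:R * phi).
have := is_derive_chain (g := fun x : R => k%:R * x) D D1 => D2.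
by apply: is_derive_eq; rewrite /GRing.scale/=; ring.
Qed.

Lemma cont_azim b k : continuous (azim b k).
Proof. by case: b; rewrite /azim; cont. Qed.

Lemma cont_azim' b k : continuous (azim' b k).
Proof. by case: b; rewrite /azim'; cont. Qed.

Lemma cont_polar k p : continuous (polar k p).
Proof. by rewrite /polar; cont. Qed.

Lemma cont_spolar' k p : continuous (spolar' k p).
Proof. by rewrite /spolar'; cont. Qed.

Lemma is_derive_horner_cos p (theta : R) :
  is_derive theta 1 (fun x => p.[cos x]) (- sin theta * p^`().[cos theta]).
Proof.
have D : is_derive (cos theta) 1 (horner p) p^`().[cos theta].
  apply: DeriveDef; first exact: derivable_horner.
  by rewrite -derive1E derivE.
by rewrite mulrC; apply: (is_derive_chain (g := cos) D).
Qed.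

Lemma is_derive_sinX k (theta : R) :
  is_derive theta 1 (fun x => sin x ^+ k) (k%:R * sin theta ^+ k.-1 * cos theta).
Proof.
have D : is_derive (sin theta) 1 (fun y : R => y ^+ k) (k%:R * sin theta ^+ k.-1).
  apply: DeriveDef; first exact: exprn_derivable.
  by rewrite exp_derive [_ *: _]mulr1.
exact: (is_derive_chain (g := sin) D (is_derive_sin theta)).
Qed.

Lemma is_derive_polar k p (theta : R) : sin theta != 0 ->
  is_derive theta 1 (polar k p) (spolar' k p theta / sin theta).
Proof.
move=> s0; have D1 := is_derive_sinX k theta.
have D2 := is_derive_horner_cos p theta.
apply: is_derive_eq; rewrite /GRing.scale/= /spolar'.
case: k {D1} => [|k] /=; first by rewrite !mul0r !expr0 !expr2; field.
by rewrite !exprS; field.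
Qed.

(** The polar equation of the separated eigenvalue problem. *)
Lemma is_derive_spolar' k p lam (theta : R) : gegenbauer k lam p -> sin theta != 0 ->
  is_derive theta 1 (spolar' k p)
    ((k%:R ^+ 2 / sin theta - lam * sin theta) * polar k p theta).
Proof.
move=> hp s0; have D1 := is_derive_sinX k theta.
have D1' := is_derive_sinX k.+2 theta.
have D2 := is_derive_horner_cos p theta.
have D3 := is_derive_horner_cos p^`() theta.
apply: is_derive_eq; rewrite /GRing.scale/= /polar.
have := hp (cos theta).
have c2 : 1 - cos theta ^+ 2 = sin theta ^+ 2 by rewrite sin2cos2.
rewrite c2 => E.
have {}E : lam * p.[cos theta] = k%:R * k.+1%:R * p.[cos theta]
   + 2 * k.+1%:R * cos theta * p^`().[cos theta]
   - sin theta ^+ 2 * p^`()^`().[cos theta] by lra.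
transitivity (sin theta ^+ k * (k%:R ^+ 2 / sin theta * p.[cos theta] -
   sin theta * (lam * p.[cos theta]))); last by ring.
have c2' : cos theta * cos theta = 1 - sin theta ^+ 2 by rewrite -c2; ring.
rewrite E; case: k {D1 D1' hp E} => [|k] /=.
  by rewrite !mul0r !expr0 !exprS; field.
have -> : cos theta * (k.+1%:R * (k.+1%:R * sin theta ^+ k * cos theta)) =
    k.+1%:R * k.+1%:R * sin theta ^+ k * (cos theta * cos theta) by ring.
rewrite c2' !exprS -[k.+3%:R]natr1 -[k.+2%:R]natr1.
by field.
Qed.

End Modes.

Section Green.
Context {R : realType}.
Implicit Types (p : {poly R}) (k m : nat) (b e : bc).

(** The inner product on the sphere of [u] with the mode [polar k p * azim b k],
    up to the constant [pi / 2 * (pi / m)] from rescaling the chart to the unit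
    square. *)
Definition pairing m b k p (u : 'rV[R]_3 -> R) : R :=
  int01 (fun x => int01 (fun y => azim b k (pi / m%:R * y) *
    (sin (pi / 2 * x) * polar k p (pi / 2 * x) *
     u (sph (pi / 2 * x, pi / m%:R * y))))).

Lemma sin_natmul_pi k : sin (k%:R * pi : R) = 0.
Proof.
elim: k => [|k IH]; first by rewrite mul0r sin0.
by rewrite -natr1 mulrDl mul1r sinDpi IH oppr0.
Qed.

Lemma sin_mul_pim m k : (1 <= m)%N -> sin ((m * k)%:R * (pi / m%:R) : R) = 0.
Proof.
move=> m1; have -> : (m * k)%:R * (pi / m%:R) = k%:R * pi :> R.
  by rewrite natrM; field; rewrite pnatr_eq0 -lt0n.
exact: sin_natmul_pi.
Qed.

Lemma pi2_gt0 : 0 < pi / 2 :> R.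
Proof. by rewrite divr_gt0// pi_gt0. Qed.

Lemma pim_gt0 m : (1 <= m)%N -> 0 < pi / m%:R :> R.
Proof. by move=> m1; rewrite divr_gt0 ?pi_gt0// ltr0n. Qed.

(** Green's formula: [lam - l] times the inner product of the mode [Y] and [u] is
    the integral of the divergence of [u grad Y - Y grad u], up to sign, and this
    field has no flux through the boundary.  The field is written in the chart
    ([Xi], [Ups]); it extends continuously to the pole because the derivative of
    [u \o sph] in the longitude is [sin theta] times a continuous function. *)
Lemma eigenfunction_orthogonal m b e (l lam : R) u k p : (1 <= m)%N ->
  eigenfunction m b e l u -> gegenbauer (m * k) lam p -> equator_bc e p ->
  lam != l -> pairing m b (m * k) p u = 0.
Proof.
move=> m1 [[/= du cdu] [/= dv dvv] pde bcm bce] hp he lamNl.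
have {}du q : differentiable u q by exact: du.
have {}cdu v : continuous (fun q => 'D_v u q) by move=> q; exact: cdu.
set kap := (m * k)%N.
pose v := u \o @sph R.
pose vt (q : R * R) := 'D_((1, 0) : R * R) v q.
pose wn (q : R * R) := 'D_(meridian_normal q.2) u (sph q).
pose vp (q : R * R) := 'D_((0, 1) : R * R) v q.
have cv : continuous v by exact: cont_C1_sph.
have cvt : continuous vt by exact: cont_sph_theta.
have cwn : continuous wn by exact: cont_sph_normal.
have cF := @cont_azim R b kap; have cF1 := @cont_azim' R b kap.
have cG := @cont_polar R kap p; have cS := @cont_spolar' R kap p.
pose Xi (q : R * R) := azim b kap q.2 *
  (sin q.1 * polar kap p q.1 * vt q - spolar' kap p q.1 * v q).
pose Ups (q : R * R) := azim b kap q.2 * (polar kap p q.1 * wn q)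
  - v q * (polar kap.-1 p q.1 * azim' b kap q.2).
pose W (q : R * R) := 'D_((0, 1) : R * R) (fun q => 'D_((0, 1) : R * R) v q) q.
pose f (q : R * R) := (lam - l) *
  (azim b kap q.2 * (sin q.1 * polar kap p q.1 * v q)).
pose dUps (q : R * R) := polar kap p q.1 / sin q.1 *
  (azim b kap q.2 * W q + kap%:R ^+ 2 * (azim b kap q.2 * v q)).
have cG1 := @cont_polar R kap.-1 p.
have sin_kap (y : R) : y = 0 \/ y = pi / m%:R -> sin (kap%:R * y) = 0.
  move=> [->|->]; first by rewrite mulr0 sin0.
  exact: sin_mul_pim.
have : int01 (fun x => int01 (fun y => f (pi / 2 * x, pi / m%:R * y))) = 0.
  apply: (@divergence_rectangle R (pi / 2) (pi / m%:R) Xi Ups f dUps).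
  - exact: pi2_gt0.
  - exact: pim_gt0.
  - by rewrite /Xi; cont.
  - by rewrite /Ups; cont.
  - by rewrite /f; cont.
  - move=> q q1 q2.
    have s0 : sin q.1 != 0.
      rewrite gt_eqF//; apply: sin_gt0_pi; case/andP: q1 => -> /=.
      by have := @pi_gt0 R; lra.
    have qi : half_lune_chart_int m q by [].
    have [dD1 _] := dvv (1, 0); have [dD2 cD2] := dvv (0, 1).
    have vpE q' : vp q' = sin q'.1 * wn q'.
      by have [_] := is_derive_sph_phi du q'.
    split.
    + pose Z := 'D_((1, 0) : R * R) (fun q : R * R => sin q.1 * vt q) q.
      have DZ : is_derive q.1 1 (fun x => sin x * vt (x, q.2)) Z.
        have D1 : is_derive q ((1, 0) : R * R) vt ('D_((1, 0) : R * R) vt q).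
          by apply: DeriveDef => //; apply: diff_derivable; exact: dD1.
        move/is_derive_fst in D1.
        have D2 : is_derive q.1 1 (fun x => sin x * vt (x, q.2))
            (sin q.1 * 'D_((1, 0) : R * R) vt q + vt (q.1, q.2) * cos q.1).
          exact: is_derive_eq.
        have [_ E] := (is_derive_fst (fun q : R * R => sin q.1 * vt q) q _).2 D2.
        by rewrite /Z E.
      have Dv : is_derive q.1 1 (fun x => v (x, q.2)) (vt q).
        apply/is_derive_fst; apply: DeriveDef => //.
        by have [] := is_derive_sph_theta du q.
      have DG := is_derive_polar kap p s0.
      have DS := is_derive_spolar' hp s0.
      have E : Z = - l * sin q.1 * v q - W q / sin q.1.
        have := pde q qi; rewrite /laplace_beltrami -/Z -/(W q) -/(v q) => E.
        have -> : - l * sin q.1 * v q = - (sin q.1 * (l * v q)) by ring.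
        rewrite -E.
        by field.
      have D : is_derive q.1 1 (fun x => azim b kap q.2 *
         (polar kap p x * (sin x * vt (x, q.2)) - spolar' kap p x * v (x, q.2)))
         (f q - dUps q).
        apply: is_derive_eq; rewrite /GRing.scale/= E /f /dUps -surjective_pairing.
        rewrite -/kap; by field.
      rewrite (_ : (fun x => Xi (x, q.2)) = (fun x => azim b kap q.2 *
         (polar kap p x * (sin x * vt (x, q.2)) - spolar' kap p x * v (x, q.2))))//.
      by apply/funext => x; rewrite /Xi /=; ring.
    + have DW : is_derive q.2 1 (fun y => vp (q.1, y)) (W q).
        apply/is_derive_snd; apply: DeriveDef => //.
        by apply: diff_derivable; exact: dD2.
      have Dv : is_derive q.2 1 (fun y => v (q.1, y)) (vp q).
        apply/is_derive_snd; apply: DeriveDef => //.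
        by have [] := is_derive_sph_phi du q.
      have DF := is_derive_azim b kap q.2.
      have DF1 := is_derive_azim' b kap q.2.
      rewrite (_ : (fun y => Ups (q.1, y)) = (fun y =>
         polar kap p q.1 / sin q.1 * (azim b kap y * vp (q.1, y)) -
         polar kap.-1 p q.1 * (v (q.1, y) * azim' b kap y))); last first.
        apply/funext => y; rewrite /Ups vpE /=; field.
        exact: s0.
      apply: is_derive_eq; rewrite /GRing.scale/= /dUps -!surjective_pairing.
      rewrite /polar /azim'.
      case: (kap) => [|j] /=; first by rewrite !expr0; field.
      by rewrite !exprS; field.
    + have cW : {for q, continuous W} by exact: cD2.
      have cs : {for q, continuous (fun q : R * R => (sin q.1)^-1)}.
        apply: cvgV => //.
        by have cs' : continuous (fun q : R * R => sin q.1); [cont|exact: cs'].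
      have cl (g : R * R -> R) : continuous g -> {for q, continuous g} by move=> cg; exact: cg.
      rewrite /dUps; apply: cvgM.
        by apply: cvgM => //; apply: cl; cont.
      apply: cvgD; first by apply: cvgM => //; apply: cl; cont.
      by apply: cl; cont.
  - move=> y yy; rewrite /Xi /= /polar /spolar'; split.
      rewrite sin0 !mul0r exprS !mul0r subr0.
      by case: (kap) => [|j]; rewrite ?exprS !(mul0r, mulr0, subr0).
    rewrite sin_pihalf cos_pihalf !(mulr0, mul0r, expr1n, mul1r) sub0r.
    have := bce y yy; case: (e) he => /= he.
      rewrite he => Dw.
      suff -> : vt (pi / 2, y) = 0 by rewrite !(mulr0, oppr0, mul0r, subr0).
      have [_ E] := is_derive_sph_theta du (pi / 2, y).
      rewrite /vt E /sph_theta /= cos_pihalf sin_pihalf derive_vec3// Dw.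
      by rewrite !(mul0r, mulr0, addr0).
    by rewrite he => Du; rewrite /v /= Du !(mul0r, mulr0, subr0).
  - move=> x xx; have [bc0 bcpi] := bcm x xx.
    have s0 := sin_kap 0 (or_introl erefl).
    have s1 := sin_kap _ (or_intror erefl).
    rewrite /bc_holds /Ups /wn /v /azim /azim' /= in bc0 bcpi *.
    case: (b) bc0 bcpi => bc0 bcpi.
      by rewrite bc0 bcpi s0 s1 !(mulr0, oppr0, subr0).
    by rewrite bc0 bcpi s0 s1 !(mulr0, mul0r, oppr0, subr0).
move=> int0; apply/eqP; move: int0 => /eqP.
have cf0 : continuous (fun q : R * R => azim b kap (pi / m%:R * q.2) *
    (sin (pi / 2 * q.1) * polar kap p (pi / 2 * q.1) *
     v (pi / 2 * q.1, pi / m%:R * q.2))) by cont.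
rewrite (@eq_int01 _ _ (fun x => (lam - l) * int01 (fun y =>
    azim b kap (pi / m%:R * y) *
    (sin (pi / 2 * x) * polar kap p (pi / 2 * x) *
     v (pi / 2 * x, pi / m%:R * y))))); last first.
  move=> x _; rewrite -int01Z//.
  by apply: (cont_comp (h := fun y => (x, y)) cf0); cont.
rewrite int01Z; last first.
  by apply: (cont_int01 (F := fun x y => azim b kap (pi / m%:R * y) *
    (sin (pi / 2 * x) * polar kap p (pi / 2 * x) *
     v (pi / 2 * x, pi / m%:R * y)))).
by rewrite mulf_eq0 subr_eq0 (negPf lamNl).
Qed.

End Green.

(** * The polar polynomials *)

Section Gegenbauer.
Context {R : realType}.
Implicit Types (k r n i j : nat).

Definition sph_eig n : R := n%:R * n.+1%:R.

(** The coefficient of ['X^(r + 2 * j)] in the power series solution of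
    Gegenbauer's equation with parameter [k] and eigenvalue [sph_eig n]. *)
Fixpoint gcoef k r n j : R :=
  if j is j'.+1 then
    (sph_eig (r + 2 * j' + k) - sph_eig n) /
      ((r + 2 * j').+1%:R * (r + 2 * j').+2%:R) * gcoef k r n j'
  else 1.

(** For [n = k + r + 2 * i] the series stops at degree [r + 2 * i]. *)
Definition gegen k r i : {poly R} :=
  \sum_(j < i.+1) gcoef k r (k + r + 2 * i) j *: 'X^(r + 2 * j).

Lemma sph_eig_inj : injective sph_eig.
Proof.
move=> n n'; rewrite /sph_eig -!natrM => /eqP; rewrite eqr_nat => /eqP; nia.
Qed.

Lemma gcoef_neq0 k r n j : (k + r + 2 * j <= n)%N -> gcoef k r n j != 0.
Proof.
elim: j => [_|j IH jn] /=; first exact: oner_neq0.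
rewrite mulf_neq0 ?IH//; last by lia.
rewrite mulf_neq0 ?invr_eq0 ?mulf_neq0 ?pnatr_eq0// subr_eq0.
by apply/eqP => /sph_eig_inj; lia.
Qed.

Definition gegen_op k (lam : R) (p : {poly R}) (z : R) : R :=
  (1 - z ^+ 2) * p^`()^`().[z] - 2 * k.+1%:R * z * p^`().[z]
  + (lam - k%:R * k.+1%:R) * p.[z].

Lemma gegen_opD k lam p q z :
  gegen_op k lam (p + q) z = gegen_op k lam p z + gegen_op k lam q z.
Proof. by rewrite /gegen_op !derivD !hornerD; ring. Qed.

Lemma gegen_opXn k n c a z : gegen_op k (sph_eig n) (c *: 'X^a) z =
  c * (a%:R * (a%:R - 1) * z ^+ a.-2 - (sph_eig (a + k) - sph_eig n) * z ^+ a).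
Proof.
rewrite /gegen_op !derivZ derivXn derivMn derivXn !hornerZ !hornerMn !hornerXn.
case: a => [|[|a]] /=.
- by rewrite !mulr0n !expr0 /sph_eig -natr1; ring.
- by rewrite !mulr0n !mulr1n !expr1 !expr0 /sph_eig add1n -[k.+2%:R]natr1; ring.
have E2 : a.+2%:R = a%:R + 2 :> R by rewrite -addn2 natrD.
have E1 : a.+1%:R = a%:R + 1 :> R by rewrite -addn1 natrD.
have Ek : k.+1%:R = k%:R + 1 :> R by rewrite -addn1 natrD.
have Ek2 : (a.+2 + k)%:R = a%:R + 2 + k%:R :> R by rewrite natrD E2.
have Ek3 : (a.+2 + k).+1%:R = a%:R + 2 + k%:R + 1 :> R by rewrite -addn1 natrD Ek2.
have Mn (x : R) j : x *+ j = j%:R * x by rewrite mulr_natl.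
rewrite (Mn (z ^+ a)) (Mn (z ^+ a.+1)) (Mn (_ * z ^+ a)) /sph_eig Ek3 Ek2 E2 E1 Ek !exprS; ring.
Qed.

(** The recurrence makes consecutive terms cancel; only the last one remains. *)
Lemma gegen_op_partial k r n i z : (r <= 1)%N ->
  gegen_op k (sph_eig n) (\sum_(j < i.+1) gcoef k r n j *: 'X^(r + 2 * j)) z =
  - gcoef k r n i * (sph_eig (r + 2 * i + k) - sph_eig n) * z ^+ (r + 2 * i).
Proof.
move=> r1; elim: i => [|i IH].
  rewrite big_ord_recl big_ord0 addr0 gegen_opXn muln0 addn0.
  by case: r r1 => [|[|//]] _; ring.
rewrite big_ord_recr gegen_opD IH /= gegen_opXn.
have -> : (r + 2 * i.+1 = (r + 2 * i).+2)%N by lia.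
set a := (r + 2 * i)%N => /=.
have a1 : a.+1%:R != 0 :> R by rewrite pnatr_eq0.
have a2 : a.+2%:R != 0 :> R by rewrite pnatr_eq0.
rewrite (_ : a.+2%:R - 1 = a.+1%:R :> R); last by rewrite -[a.+2%:R]natr1; ring.
by field; apply/andP.
Qed.

Lemma gegen_eq k r i : (r <= 1)%N ->
  gegenbauer k (sph_eig (k + r + 2 * i)) (gegen k r i).
Proof.
move=> r1 z; rewrite -/(gegen_op _ _ _ _) gegen_op_partial//.
by rewrite (_ : (r + 2 * i + k = k + r + 2 * i)%N) ?subrr ?mulr0 ?mul0r//; lia.
Qed.

(** The parity in [cos theta] of the polar polynomials for the condition [e]. *)
Definition parity e : nat := if e is Neumann then 0 else 1.

Lemma parity_le1 e : (parity e <= 1)%N. Proof. by case: e. Qed.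

Lemma gegen_factor k r i : exists2 q : {poly R},
  gegen k r i = 'X^r * q & q.[0] = 1.
Proof.
exists (\sum_(j < i.+1) gcoef k r (k + r + 2 * i) j *: 'X^(2 * j)).
  by rewrite mulr_sumr; apply: eq_bigr => j _; rewrite -scalerAr exprD.
rewrite horner_sum big_ord_recl muln0 hornerZ hornerXn mulr1 big1 ?addr0// => j _.
by rewrite hornerZ hornerXn expr0n muln_eq0 mulr0.
Qed.

Lemma gegen_equator_bc k e i : equator_bc e (gegen k (parity e) i).
Proof.
case: e; rewrite /equator_bc /=.
  rewrite /gegen (raddf_sum (@deriv R)) horner_sum big1// => j _.
  rewrite /= derivZ derivXn hornerZ hornerMn hornerXn.
  case: (nat_of_ord j) => [|j']; first by rewrite muln0 mulr0n mulr0.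
  by rewrite expr0n (_ : _ == 0%N = false) ?mul0rn ?mulr0//; apply/negbTE; lia.
have [q -> _] := gegen_factor k 1 i.
by rewrite hornerM hornerXn expr1 mul0r.
Qed.

(** [M j] stands for the value of a linear form on ['X^(r + 2 * j)]: a form that
    vanishes on the polynomials [gegen k r i] vanishes on these monomials, as the
    coefficients form a triangular matrix with nonzero diagonal. *)
Lemma gegen_span k r (M : nat -> R) :
  (forall i, \sum_(j < i.+1) gcoef k r (k + r + 2 * i) j * M j = 0) ->
  forall j, M j = 0.
Proof.
move=> H j; elim/ltn_ind: j => j IH.
have := H j; rewrite big_ord_recr big1 /= ?add0r; last first.
  by move=> i _; rewrite IH ?mulr0.
by move/eqP; rewrite mulf_eq0 (negPf (gcoef_neq0 _))//= => /eqP.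
Qed.

End Gegenbauer.

(** * Completeness of the modes *)

Section Completeness.
Context {R : realType}.
Implicit Types (p : {poly R}) (k m i j : nat) (b e : bc).

(** The least [k] with [azim b k <> 0]. *)
Definition kmin b : nat := if b is Neumann then 0 else 1.

Lemma int01_horner_eq0 (w X : R -> R) : continuous w -> continuous X ->
  (forall j, int01 (fun x => w x * X x ^+ j) = 0) ->
  forall q : {poly R}, int01 (fun x => w x * q.[X x]) = 0.
Proof.
move=> cw cX H q; elim/poly_ind: q w cw H => [|q c IH] w cw H.
  rewrite -[RHS](int01_cst (0 : R)); apply: eq_int01 => x _.
  by rewrite horner0 mulr0.
rewrite (@eq_int01 _ _ (fun x => w x * X x * q.[X x] + c * w x)); last first.
  by move=> x _; rewrite !hornerE; ring.
rewrite int01D; [|by cont|by cont].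
rewrite IH ?add0r; [|by cont|].
  rewrite int01Z//; have := H 0%N; under eq_int01 => x _ do rewrite expr0 mulr1.
  by move=> ->; rewrite mulr0.
move=> j; have := H j.+1; under eq_int01 => x _ do rewrite exprS mulrA.
by [].
Qed.

Lemma int01_sum (I : Type) (s : seq I) (c : I -> R) (w : R -> R) (f : I -> R -> R) :
  continuous w -> (forall t, continuous (f t)) ->
  \sum_(t <- s) c t * int01 (fun x => w x * f t x) =
  int01 (fun x => w x * \sum_(t <- s) c t * f t x).
Proof.
move=> cw cf; suff [] : continuous (fun x => \sum_(t <- s) c t * f t x) /\
  \sum_(t <- s) c t * int01 (fun x => w x * f t x) =
  int01 (fun x => w x * \sum_(t <- s) c t * f t x) by [].
elim: s => [|t0 s [IH1 IH2]].
  split; first by rewrite (_ : (fun x => _) = (fun=> 0)); [cont|apply/funext => x; rewrite big_nil].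
  rewrite big_nil -[LHS](int01_cst (0 : R)); apply: eq_int01 => x _.
  by rewrite big_nil mulr0.
have cfi := cf t0.
split.
  rewrite (_ : (fun x => _) = (fun x => c t0 * f t0 x + \sum_(t <- s) c t * f t x)).
    by cont.
  by apply/funext => x; rewrite big_cons.
rewrite big_cons IH2 -int01Z; last by cont.
rewrite -int01D; [|by cont|by cont]; apply: eq_int01 => x _.
by rewrite big_cons; ring.
Qed.

Lemma cos_inj_0pi (x y : R) : 0 <= x <= pi -> 0 <= y <= pi -> cos x = cos y -> x = y.
Proof. by move=> x0 y0; apply: cos_inj; rewrite in_itv. Qed.

(** By the product-to-sum formulas, [cos a ^ j * azim b k a] is a combination of
    the [azim b k' a]. *)
Lemma azim_cos_moments b (h al : R -> R) : continuous h -> continuous al ->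
  (forall k, (kmin b <= k)%N -> int01 (fun y => azim b k (al y) * h y) = 0) ->
  forall j k, int01 (fun y => azim b k (al y) * h y * cos (al y) ^+ j) = 0.
Proof.
move=> ch cal H j; elim: j h ch H => [|j IH] h ch H k.
  under eq_int01 => y _ do rewrite expr0 mulr1.
  have [kk|kk] := leqP (kmin b) k; first exact: H.
  have [-> ->] : b = Dirichlet /\ k = 0%N by case: b kk {H} => //; case: k.
  rewrite -[RHS](int01_cst (0 : R)); apply: eq_int01 => y _.
  by rewrite /azim mul0r sin0 mul0r.
have cA b' k' := @cont_azim R b' k'.
under eq_int01 => y _ do rewrite exprS mulrA -[X in X * _]mulrA.
apply: (IH (fun y => h y * cos (al y))); first by cont.
move=> {}k kk; case: k kk => [|k] kk.
  have bN : b = Neumann by case: b kk {IH H}.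
  rewrite bN in H *; have := H 1%N isT.
  by under eq_int01 => y _ do rewrite /azim mul1r;
     under [in X in _ -> X = _]eq_int01 => y _ do
       rewrite /azim mul0r cos0 mul1r mulrC.
rewrite (@eq_int01 _ _ (fun y => 2^-1 *
   (azim b k.+2 (al y) * h y + azim b k (al y) * h y))); last first.
  move=> y _; set a := al y.
  have E2 : k.+2%:R * a = k.+1%:R * a + a by rewrite -[k.+2%:R]natr1; ring.
  have E0 : k%:R * a = k.+1%:R * a - a by rewrite -[k.+1%:R]natr1; ring.
  case: (b); rewrite /azim E2 E0.
    by rewrite cosB cosD; field.
  by rewrite sinB sinD; field.
have cA0 := cA b k; have cA2 := cA b k.+2.
rewrite int01Z; last by cont.
rewrite int01D; [|by cont|by cont].
rewrite H ?add0r; last by lia.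
have [kk'|kk'] := leqP (kmin b) k; first by rewrite H ?mulr0.
have [-> ->] : b = Dirichlet /\ k = 0%N by case: b kk' {IH H kk cA0 cA2} => //; case: k.
rewrite (@eq_int01 _ _ (fun=> 0)) ?int01_cst ?mulr0// => y _.
by rewrite /azim mul0r sin0 mul0r.
Qed.

Lemma cont_eq0 (h : R -> R) : continuous h ->
  (forall y, 0 < y < 1 -> h y = 0) -> forall y, 0 <= y <= 1 -> h y = 0.
Proof.
move=> ch H y /andP[y0 y1].
have cu : continuous (fun t : R => h ((1 - t) * y + t * 2^-1)) by cont.
have H1 : (fun t : R => h ((1 - t) * y + t * 2^-1)) @ 0^'+ -->
    h ((1 - 0) * y + 0 * 2^-1).
  by apply: cvg_at_right_filter; exact: cu.
have H2 : (fun t : R => h ((1 - t) * y + t * 2^-1)) @ 0^'+ --> (0 : R).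
  apply: (cvg_trans (G := (fun=> 0) @ 0^'+)); last exact: cvg_cst.
  apply: near_eq_cvg; near=> t.
  have t0 : 0 < t by near: t; exact: nbhs_right_gt.
  have t1 : t < 1 by near: t; exact: nbhs_right_lt.
  rewrite H//; apply/andP; split; nra.
have := cvg_unique _ H1 H2.
by rewrite subr0 mul1r mul0r addr0; apply.
Unshelve. all: by end_near.
Qed.

(** For fixed [k], the azimuthal coefficient [a k] of [u] is orthogonal, with a
    positive weight, to the even (or odd) polynomials in [cos theta], so it
    vanishes by the moment problem in the coordinate [cos theta ^ 2].  Then, for
    fixed [theta], [u] is orthogonal to all [azim b k], so it vanishes by the
    moment problem in the coordinate [cos (m phi)]. *)
Lemma modes_complete m b e (u : 'rV[R]_3 -> R) : (1 <= m)%N ->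
  continuous (u \o @sph R) ->
  (forall k i, (kmin b <= k)%N ->
     pairing m b (m * k) (gegen (m * k) (parity e) i) u = 0) ->
  forall q, half_lune m q -> u q = 0.
Proof.
move=> m1 cv H.
set v := u \o @sph R in cv; have vE q : u (sph q) = v q by [].
have cA k := @cont_azim R b k.
have cP k p := @cont_polar R k p.
pose th (x : R) := pi / 2 * x; pose ph (y : R) := pi / m%:R * y.
have cth : continuous th by rewrite /th; cont.
have cph : continuous ph by rewrite /ph; cont.
have pi0 := @pi_gt0 R.
have mn0 : m%:R != 0 :> R by rewrite pnatr_eq0 -lt0n.
pose a k x := int01 (fun y => azim b (m * k) (ph y) * v (th x, ph y)).
have ca k : continuous (a k).
  apply: (cont_int01 (F := fun x y => azim b (m * k) (ph y) * v (th x, ph y))).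
  by have := cA (m * k)%N => cA'; cont.
have thin x : 0 < x < 1 -> 0 < sin (th x) /\ 0 < cos (th x).
  move=> /andP[x0 x1]; rewrite /th; split.
    by apply: sin_gt0_pi; apply/andP; split; nra.
  by apply: cos_gt0_pihalf; apply/andP; split; nra.
have a0 k x : (kmin b <= k)%N -> 0 < x < 1 -> a k x = 0.
  move=> kk xx; set kap := (m * k)%N.
  pose w x := sin (th x) ^+ kap.+1 * a k x * cos (th x) ^+ parity e.
  have cw : continuous w by have := ca k => cak; rewrite /w; cont.
  have w0 : w x = 0.
    apply: (@moments_eq0 _ (fun x => cos (th x) ^+ 2) w); [by cont|by []| | |].
    - move=> s t /andP[s0 s1] /andP[t0 t1] /eqP.
      have th0 z : 0 <= z -> z <= 1 -> 0 <= th z <= pi / 2.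
        by move=> z0 z1; rewrite /th; apply/andP; split; nra.
      have thc z : 0 <= z -> z <= 1 -> 0 <= cos (th z).
        move=> z0 z1; apply: cos_ge0_pihalf.
        by have /andP[] := th0 z z0 z1; move=> *; apply/andP; split; lra.
      rewrite eqrXn2// ?thc// => /eqP E.
      have {}E : th s = th t.
        apply: cos_inj_0pi E.
          by have /andP[] := th0 s s0 s1; move=> *; apply/andP; split; lra.
        by have /andP[] := th0 t t0 t1; move=> *; apply/andP; split; lra.
      by move: E; rewrite /th => /mulfI; apply; rewrite gt_eqF// pi2_gt0.
    - apply: int01_horner_eq0; [by []|by cont|].
      apply: (@gegen_span R kap (parity e)) => i.
      rewrite -[RHS](H k i kk) /pairing -/kap.
      rewrite (int01_sum _ (fun j : 'I_i.+1 => gcoef kap (parity e) (kap + parity e + 2 * i) j)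
        (f := fun (j : 'I_i.+1) x => (cos (th x) ^+ 2) ^+ j))//; last by move=> j'; cont.
      apply: eq_int01 => s _; rewrite -/(th s).
      have cA' := cA kap.
      rewrite (@eq_int01 _ _ (fun y => (sin (th s) * polar kap (gegen kap (parity e) i) (th s)) *
        (azim b kap (ph y) * v (th s, ph y)))); last first.
        by move=> y _; rewrite vE -/(ph y); ring.
      rewrite int01Z; last by cont.
      rewrite -/(a k s) /w /polar /gegen horner_sum exprS.
      rewrite !mulr_sumr mulr_suml; apply: eq_bigr => j' _.
      by rewrite hornerZ hornerXn exprD exprM; ring.
    - by case/andP: xx => x0 x1; rewrite !ltW.
  move/eqP: w0; have [s0 c0] := thin x xx.
  by rewrite /w !mulf_eq0 !expf_eq0 (gt_eqF s0) (gt_eqF c0) !andbF orbF/= => /eqP.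
have v0 x y : 0 < x < 1 -> 0 < y < 1 -> v (th x, ph y) = 0.
  move=> xx yy.
  pose al (y : R) := pi * y.
  have cal : continuous al by rewrite /al; cont.
  pose w y := azim b (kmin b) (al y) * v (th x, ph y).
  have cw : continuous w by have := cA (kmin b) => cA'; rewrite /w; cont.
  have w0 : w y = 0.
    apply: (@moments_eq0 _ (fun y => cos (al y)) w); [by cont|by []| | |].
    - move=> s t /andP[s0 s1] /andP[t0 t1].
      have al0 z : 0 <= z -> z <= 1 -> 0 <= al z <= pi.
        by move=> z0 z1; rewrite /al; apply/andP; split; nra.
      move/(cos_inj_0pi (al0 _ s0 s1) (al0 _ t0 t1)); rewrite /al => /mulfI; apply.
      by rewrite gt_eqF.
    - apply: int01_horner_eq0; [by []|by cont|] => j.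
      apply: (@azim_cos_moments b (fun y => v (th x, ph y)) al _ _ _ j (kmin b));
        [by cont|by []|].
      move=> k kk; rewrite -[RHS](a0 k x kk xx); apply: eq_int01 => t _.
      congr (_ * _); rewrite /azim /ph natrM.
      have -> : m%:R * k%:R * (pi / m%:R * t) = k%:R * al t by rewrite /al; field.
      by [].
    - by case/andP: yy => y0 y1; rewrite !ltW.
  move/eqP: w0; rewrite mulf_eq0 => /orP[|/eqP//].
  rewrite /azim /kmin /al; case: (b); first by rewrite mul0r cos0 oner_eq0.
  rewrite mul1r gt_eqF//; apply: sin_gt0_pi; case/andP: yy => y0 y1.
  by apply/andP; split; nra.
have vcl x y : 0 <= x <= 1 -> 0 <= y <= 1 -> v (th x, ph y) = 0.
  move=> xx; move: y; apply: cont_eq0; first by cont.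
  move=> y yy; move: x xx; apply: (@cont_eq0 (fun x => v (th x, ph y))); first by cont.
  by move=> x xx; exact: v0.
move=> _ [[t f] /= [/andP[t0 t1] /andP[f0 f1]] <-].
have := @vcl (t / (pi / 2)) (f / (pi / m%:R)).
have -> : th (t / (pi / 2)) = t.
  by rewrite /th mulrC divfK// gt_eqF// pi2_gt0.
have -> : ph (f / (pi / m%:R)) = f.
  by rewrite /ph mulrC divfK// gt_eqF// pim_gt0.
apply; apply/andP; split.
- by rewrite divr_ge0// ltW// pi2_gt0.
- by rewrite ler_pdivrMr ?mul1r// pi2_gt0.
- by rewrite divr_ge0// ltW// pim_gt0.
- by rewrite ler_pdivrMr ?mul1r// pim_gt0.
Qed.

End Completeness.

(** * The modes are eigenfunctions *)

Section CkRules.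
Context {R : realType} {V : normedModType R}.
Implicit Types (f g : V -> R) (n : nat).

Lemma Ck_sub n (A B : set V) f : A `<=` B -> Ck n B f -> Ck n A f.
Proof.
move=> AB; elim: n f => [|n IH] f /=; first by move=> H p /AB; exact: H.
by move=> [H1 H2]; split=> [p /AB|v]; [exact: H1|apply: IH; exact: H2].
Qed.

Lemma Ck_leS n f : Ck n.+1 setT f -> Ck n setT f.
Proof.
elim: n f => [|n IH] f /=.
  by move=> [H _] p _; apply: differentiable_continuous; exact: H.
by move=> [H1 H2]; split=> // v; apply: IH; exact: H2.
Qed.

Lemma Ck_cst n (c : R) : Ck n setT (fun _ : V => c).
Proof.
elim: n c => [|n IH] c /=; first by move=> p _; exact: cvg_cst.
split=> [p _|v]; first exact: differentiable_cst.
rewrite (_ : 'D_v (fun=> c) = (fun=> 0)); first exact: IH.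
by apply/funext => p; exact: derive_cst.
Qed.

Lemma CkD n f g : Ck n setT f -> Ck n setT g -> Ck n setT (fun p => f p + g p).
Proof.
elim: n f g => [|n IH] f g /=.
  by move=> cf cg p _; apply: cvgD; [exact: cf|exact: cg].
move=> [df cf] [dg cg]; split=> [p _|v].
  by apply: differentiableD; [exact: df|exact: dg].
rewrite (_ : 'D_v (fun p => f p + g p) = (fun p => 'D_v f p + 'D_v g p)).
  exact: (IH _ _ (cf v) (cg v)).
by apply/funext => p; apply: deriveD; apply: diff_derivable; [exact: df|exact: dg].
Qed.

Lemma CkM n f g : Ck n setT f -> Ck n setT g -> Ck n setT (fun p => f p * g p).
Proof.
elim: n f g => [|n IH] f g.
  by move=> /= cf cg p _; apply: cvgM; [exact: cf|exact: cg].
move=> Cf Cg; have [df cf] := Cf; have [dg cg] := Cg; split=> [p _|v].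
  by apply: differentiableM; [exact: df|exact: dg].
rewrite (_ : 'D_v (fun p => f p * g p) = (fun p => f p * 'D_v g p + g p * 'D_v f p)).
  apply: CkD.
    exact: (IH _ _ (Ck_leS Cf) (cg v)).
  exact: (IH _ _ (Ck_leS Cg) (cf v)).
by apply/funext => p; apply: deriveM; apply: diff_derivable; [exact: df|exact: dg].
Qed.

Lemma CkN n f : Ck n setT f -> Ck n setT (fun p => - f p).
Proof.
move=> Cf; rewrite (_ : (fun p => _) = (fun p => -1 * f p)).
  by apply: CkM => //; exact: Ck_cst.
by apply/funext => p; rewrite mulN1r.
Qed.

Lemma Ck_horner n f (p : {poly R}) : Ck n setT f -> Ck n setT (fun q => p.[f q]).
Proof.
move=> Cf; elim/poly_ind: p => [|p c IH].
  rewrite (_ : (fun q => _) = (fun=> 0)); first exact: Ck_cst.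
  by apply/funext => q; rewrite horner0.
rewrite (_ : (fun q => _) = (fun q => p.[f q] * f q + c)).
  by apply: CkD; [exact: CkM|exact: Ck_cst].
by apply/funext => q; rewrite !hornerE.
Qed.

Lemma Ck_trig n (L : {linear V -> R}) : continuous L ->
  Ck n setT (fun q => sin (L q)) /\ Ck n setT (fun q => cos (L q)).
Proof.
move=> cL; have dL q : differentiable L q by exact: linear_differentiable.
have d1 (F F' : R -> R) (q : V) : (forall x : R, is_derive x 1 F (F' x)) ->
    differentiable (fun q => F (L q)) q /\
    forall v, 'D_v (fun q => F (L q)) q = F' (L q) * L v.
  move=> dF.
  have dF1 : differentiable F (L q) by apply/derivable1_diffP.
  have dFL : differentiable (F \o L) q by exact: differentiable_comp.
  split=> // v; rewrite (deriveE _ dFL) diff_comp// diff_lin//= diff1E//.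
  by rewrite derive1E derive_val [_ *: _]mulrC.
elim: n => [|n [IHs IHc]].
  split=> q _; apply: (continuous_comp (f := L)).
  - exact: cL.
  - exact: continuous_sin.
  - exact: cL.
  - exact: continuous_cos.
split; split=> [q _|v].
- by have [] := d1 sin cos q (fun x => is_derive_sin x).
- rewrite (_ : 'D_v (fun q => sin (L q)) = (fun q => cos (L q) * L v)).
    by apply: CkM => //; exact: Ck_cst.
  by apply/funext => q; have [_ ->] := d1 sin cos q (fun x => is_derive_sin x).
- by have [] := d1 cos _ q (fun x => is_derive_cos x).
- rewrite (_ : 'D_v (fun q => cos (L q)) = (fun q => - sin (L q) * L v)).
    by apply: CkM; [exact: CkN|exact: Ck_cst].
  by apply/funext => q; have [_ ->] := d1 cos _ q (fun x => is_derive_cos x).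
Qed.

End CkRules.

Lemma Ck_coord {R : realType} n (i : 'I_3) :
  Ck n setT (fun p : 'rV[R]_3 => p 0 i).
Proof.
case: n => [|n]; first by move=> p _; exact: coord_continuous.
split=> [p _|v]; first exact: differentiable_coord.
rewrite (_ : 'D_v (fun p : 'rV[R]_3 => p 0 i) = (fun=> v 0 i)); first exact: Ck_cst.
apply/funext => p.
have := @derive_mx R _ 1 3 id p v (@derivable_id _ _ p v).
by rewrite derive_id => /matrixP /(_ 0 i); rewrite mxE.
Qed.

Section Modes.
Context {R : realType}.
Implicit Types (p : {poly R}) (k n : nat) (b e : bc).

(** The real and imaginary parts of [(x + iy) ^ k]. *)
Fixpoint zpow k (P : 'rV[R]_3) : R * R :=
  if k is k'.+1 then
    let z := zpow k' P in
    (P 0 0 * z.1 - P 0 1 * z.2, P 0 0 * z.2 + P 0 1 * z.1)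
  else (1, 0).

(** A mode as a polynomial function on the whole space: this shows its regularity
    at the pole, where the chart is singular. *)
Definition mode b k p (P : 'rV[R]_3) : R :=
  (if b is Neumann then (zpow k P).1 else (zpow k P).2) * p.[P 0 ord_max].

Lemma Ck_mode (V : normedModType R) n b k p (gam : V -> 'rV[R]_3) :
  (forall i, Ck n setT (fun q => gam q 0 i)) ->
  Ck n setT (fun q => mode b k p (gam q)).
Proof.
move=> Cg.
have [C1 C2] : Ck n setT (fun q => (zpow k (gam q)).1) /\
    Ck n setT (fun q => (zpow k (gam q)).2).
  elim: k => [|k [IH1 IH2]] /=; first by split; exact: Ck_cst.
  split; apply: CkD; [| apply: CkN | |]; exact: CkM.
by case: b; apply: CkM => //; exact: Ck_horner.
Qed.

Lemma zpow_sph k (q : R * R) : zpow k (sph q) =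
  (sin q.1 ^+ k * cos (k%:R * q.2), sin q.1 ^+ k * sin (k%:R * q.2)).
Proof.
elim: k => [|k IH] /=; first by rewrite !expr0 mul0r cos0 sin0 mulr1 mulr0.
rewrite IH !mxE /= -natr1 mulrDl mul1r cosD sinD !exprS.
by congr (_, _); ring.
Qed.

Lemma mode_sph b k p : mode b k p \o @sph R =
  (fun q => polar k p q.1 * azim b k q.2).
Proof.
apply/funext => q; rewrite /= /mode zpow_sph /polar /azim !mxE /=.
by case: b; rewrite /=; ring.
Qed.

Lemma Ck_sph_coord n (i : 'I_3) : Ck n setT (fun q : R * R => sph q 0 i).
Proof.
have cf : continuous (@fst R R) by move=> q; exact: cvg_fst.
have cs : continuous (@snd R R) by move=> q; exact: cvg_snd.
have [s1 c1] := @Ck_trig R (R * R)%type n fst cf.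
have [s2 c2] := @Ck_trig R (R * R)%type n snd cs.
case: i => [[|[|[|j]]] ji]; last by discriminate ji.
- rewrite (_ : (fun q => _) = (fun q => sin q.1 * cos q.2)); first exact: CkM.
  by apply/funext => q; rewrite mxE.
- rewrite (_ : (fun q => _) = (fun q => sin q.1 * sin q.2)); first exact: CkM.
  by apply/funext => q; rewrite mxE.
- rewrite (_ : (fun q => _) = (fun q => cos q.1)); first exact: c1.
  by apply/funext => q; rewrite mxE.
Qed.

End Modes.

Section ModesAreEigenfunctions.
Context {R : realType}.
Implicit Types (p : {poly R}) (k m n : nat) (b e : bc).

Lemma spolar'_sin0 k p (theta : R) : sin theta = 0 -> spolar' k p theta = 0.
Proof.
by move=> s0; rewrite /spolar' s0; case: k => [|k];
  rewrite !exprS !(mul0r, mulr0) subr0.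
Qed.

(** The conditions on the arcs are read off in the chart from the derivatives of
    the two factors. *)
Lemma mode_eigenfunction m b e k p (lam : R) : (1 <= m)%N ->
  gegenbauer (m * k) lam p -> equator_bc e p ->
  eigenfunction m b e lam (mode b (m * k) p).
Proof.
move=> m1 hp he; set kap := (m * k)%N.
set u := mode b kap p.
pose w (q : R * R) := polar kap p q.1 * azim b kap q.2.
have uE : u \o @sph R = w by exact: mode_sph.
have uE' q : u (sph q) = w q by rewrite -uE.
have C1u : Ck 1 setT u by apply: (@Ck_mode R _ 1 b kap p id) => i; exact: Ck_coord.
have [du1 cdu1] := C1u.
have du q : differentiable u q by exact: du1.
have cdu v : continuous (fun q => 'D_v u q) by move=> q; exact: cdu1.
have dphi (f g : R -> R) (q : R * R) (d : R) : is_derive q.2 1 g d ->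
    'D_((0, 1) : R * R) (fun q => f q.1 * g q.2) q = f q.1 * d.
  move=> dg; have D : is_derive q.2 1 (fun y => f q.1 * g y) (f q.1 * d).
    by apply: is_derive_eq.
  by have [_] := (is_derive_snd (fun q => f q.1 * g q.2) q _).2 D.
have dth (f g : R -> R) (q : R * R) (d : R) : is_derive q.1 1 f d ->
    'D_((1, 0) : R * R) (fun q => f q.1 * g q.2) q = d * g q.2.
  move=> df; have D : is_derive q.1 1 (fun x => f x * g q.2) (d * g q.2).
    by apply: is_derive_eq; rewrite /GRing.scale/=; ring.
  by have [_] := (is_derive_fst (fun q => f q.1 * g q.2) q _).2 D.
have wt q : sin q.1 * 'D_((1, 0) : R * R) w q = spolar' kap p q.1 * azim b kap q.2.
  have [s0|s0] := eqVneq (sin q.1) 0; first by rewrite s0 spolar'_sin0// !mul0r.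
  by rewrite (dth _ _ _ _ (is_derive_polar kap p s0)); field.
have wp q : 'D_((0, 1) : R * R) w q = polar kap p q.1 * azim' b kap q.2.
  by rewrite (dphi _ _ _ _ (is_derive_azim b kap q.2)).
have sinkap phi : phi = 0 \/ phi = pi / m%:R -> sin (kap%:R * phi) = 0 :> R.
  by case=> ->; [rewrite mulr0 sin0|exact: sin_mul_pim].
have mer theta phi : 0 <= theta <= pi / 2 -> phi = 0 \/ phi = pi / m%:R ->
    bc_holds b (meridian_normal phi) (sph (theta, phi)) u.
  move=> tt /sinkap s0; rewrite /bc_holds.
  case bE : b; last first.
    by rewrite uE' /w /azim bE /= s0 mulr0.
  (* off the pole, the derivative in the longitude gives the normal derivative;
     at the pole the condition follows by continuity *)
  pose h (t : R) := 'D_(meridian_normal phi) u (sph (pi / 2 * t, phi)).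
  have ch : continuous h.
    apply: cont_derive_vec3 => //; [|cont..].
    by rewrite /sph; apply: cont_vec3; cont.
  have h0 : forall t, 0 <= t <= 1 -> h t = 0.
    apply: cont_eq0 => // t /andP[t0 t1].
    have st : 0 < sin (pi / 2 * t).
      by apply: sin_gt0_pi; have := @pi_gt0 R; move=> ?; apply/andP; split; nra.
    have [_] := is_derive_sph_phi du (pi / 2 * t, phi).
    rewrite uE wp /azim' bE /= s0 oppr0 !mulr0 => /esym/eqP.
    by rewrite mulf_eq0 gt_eqF//= => /eqP.
  have -> : theta = pi / 2 * (theta / (pi / 2)).
    by rewrite mulrC divfK// gt_eqF// pi2_gt0.
  apply: h0; case/andP: tt => t0 t1.
  by rewrite divr_ge0 ?ler_pdivrMr ?mul1r ?pi2_gt0// ltW// pi2_gt0.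
split=> //.
- apply: (Ck_sub (B := setT)) => //.
  by apply: (@Ck_mode R _ 2 b kap p) => i; exact: Ck_sph_coord.
- move=> q [q1 q2].
  have s0 : sin q.1 != 0.
    rewrite gt_eqF//; apply: sin_gt0_pi; case/andP: q1 => -> /=.
    by have := @pi_gt0 R; lra.
  rewrite uE uE' /laplace_beltrami.
  rewrite (_ : (fun q0 : R * R => sin q0.1 * _) = (fun q => spolar' kap p q.1 * azim b kap q.2));
    last by apply/funext => q'; exact: wt.
  rewrite (dth _ _ _ _ (is_derive_spolar' hp s0)).
  rewrite (_ : (fun q0 : R * R => 'D_((0, 1) : R * R) w q0) =
      (fun q => polar kap p q.1 * azim' b kap q.2)); last by apply/funext.
  rewrite (dphi _ _ _ _ (is_derive_azim' b kap q.2)) /w.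
  rewrite -/kap; by field.
- by move=> theta tt; split; apply: mer => //; [left|right].
- move=> phi pp; have c0 := @cos_pihalf R; have s1 := @sin_pihalf R.
  rewrite /bc_holds; case: e he => /= he; last first.
    by rewrite uE' /w /polar /= c0 he mulr0 mul0r.
  have [_] := is_derive_sph_theta du (pi / 2, phi).
  have := wt (pi / 2, phi); rewrite uE /= s1 mul1r => ->.
  rewrite /spolar' c0 he !mulr0 mul0r subr0 mul0r /sph_theta /= c0 s1.
  rewrite derive_vec3// /equator_normal => E.
  by move: E; rewrite !mul0r add0r mulN1r add0r => /esym/eqP; rewrite oppr_eq0 => /eqP.
Qed.

(** Up to a factor, the integrand is the derivative of the Wronskian of the two
    functions, which vanishes at both ends. *)
Lemma azim_orthogonal b k k' : k != k' ->
  int01 (fun y => azim b k (pi * y) * azim b k' (pi * y)) = 0 :> R.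
Proof.
move=> kk.
have cA j := @cont_azim R b j; have cA' j := @cont_azim' R b j.
have c1 := cA k; have c2 := cA k'; have c3 := cA' k; have c4 := cA' k'.
pose Wr (y : R) := azim b k (pi * y) * azim' b k' (pi * y)
  - azim' b k (pi * y) * azim b k' (pi * y).
have D (y : R) : is_derive y 1 Wr (pi * (k%:R ^+ 2 - k'%:R ^+ 2) *
    (azim b k (pi * y) * azim b k' (pi * y))).
  have D0 : is_derive y 1 (fun x : R => pi * x) pi.
    by apply: is_derive_eq; rewrite /GRing.scale/=; ring.
  have A j := is_derive_chain (g := fun x : R => pi * x) (is_derive_azim b j _) D0.
  have A' j := is_derive_chain (g := fun x : R => pi * x) (is_derive_azim' b j _) D0.
  have A1 := A k; have A2 := A k'; have A3 := A' k; have A4 := A' k'.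
  by apply: is_derive_eq; rewrite /GRing.scale/=; ring.
have : int01 (fun y => pi * (k%:R ^+ 2 - k'%:R ^+ 2) *
    (azim b k (pi * y) * azim b k' (pi * y))) = Wr 1 - Wr 0.
  by apply: (int01_FTC (F := Wr)); [rewrite /Wr; cont|cont].
rewrite int01Z; last by cont.
have -> : Wr 1 - Wr 0 = 0.
  rewrite /Wr /azim /azim' mulr1 mulr0.
  by case: (b); rewrite !mulr0 !sin_natmul_pi ?sin0 !(mulr0, mul0r, oppr0, subr0).
move/eqP; rewrite !mulf_eq0 (gt_eqF (@pi_gt0 R)) subr_eq0 eqrXn2 ?ler0n//.
by rewrite eqr_nat (negPf kk) => /eqP.
Qed.

Lemma azim_norm_gt0 b k : (kmin b <= k)%N ->
  0 < int01 (fun y => azim b k (pi * y) * azim b k (pi * y)) :> R.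
Proof.
move=> kk; have c1 := @cont_azim R b k.
have y0 : exists2 y, 0 <= y <= 1 & azim b k (pi * y) != 0 :> R.
  case: b kk c1 => kk _; rewrite /azim.
    by exists 0; rewrite ?lexx ?ler01// !mulr0 cos0 oner_eq0.
  have k0 : k%:R != 0 :> R by rewrite pnatr_eq0 -lt0n.
  have k1 : 1 <= k%:R :> R by rewrite ler1n.
  exists (2 * k%:R)^-1.
    rewrite invr_ge0 mulr_ge0 ?ler0n//= invf_le1; last by lra.
    by lra.
  rewrite (_ : k%:R * _ = pi / 2) ?sin_pihalf ?oner_eq0//.
  by field.
case: y0 => y y01 ny.
apply: (@int01_gt0 _ _ y) => //; first by cont.
  by move=> x; rewrite -expr2 sqr_ge0.
by rewrite -expr2 exprn_even_gt0.
Qed.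

(** Otherwise the polynomial, deprived of its factor ['X^r], would vanish on
    ]0, 1[, against its value 1 at 0. *)
Lemma polar_gegen_neq0 k r i : exists2 x, 0 <= x <= 1 &
  polar k (gegen k r i) (pi / 2 * x) != 0 :> R.
Proof.
have [q qE q0] := @gegen_factor R k r i.
apply: contrapT => /forall2NP H.
have pi0 := @pi_gt0 R.
have Q0 (x : R) : 0 < x < 1 -> q.[cos (pi / 2 * x)] = 0.
  move=> /andP[x0 x1].
  case: (H x) => [|/negP]; first by rewrite !ltW.
  rewrite negbK /polar qE hornerM hornerXn !mulf_eq0 !expf_eq0.
  rewrite (gt_eqF (_ : 0 < sin _)); last by apply: sin_gt0_pi; apply/andP; split; nra.
  rewrite (gt_eqF (_ : 0 < cos _)); last by apply: cos_gt0_pihalf; apply/andP; split; nra.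
  by rewrite !andbF => /eqP.
have c : continuous (fun x : R => q.[cos (pi / 2 * x)]) by cont.
have := cont_eq0 c Q0 (y := 1); rewrite mulr1 cos_pihalf q0 ler01 lexx => /(_ isT)/eqP.
by rewrite oner_eq0.
Qed.

(** Integrating a linear relation against [azim b (m * ks j)] isolates the
    coefficient of index [j]. *)
Lemma modes_lin_indep m b e n (ks : 'I_n -> nat) (i_ : 'I_n -> nat) :
  (1 <= m)%N -> injective ks -> (forall j, (kmin b <= ks j)%N) ->
  lin_indep_on (@half_lune R m)
    (fun j => mode b (m * ks j) (gegen (m * ks j) (parity e) (i_ j))).
Proof.
move=> m1 iks kks c H j.
have [x x01 nx] := polar_gegen_neq0 (m * ks j) (parity e) (i_ j).
have cA k := @cont_azim R b k.
pose G (s : 'I_n) := polar (m * ks s) (gegen (m * ks s) (parity e) (i_ s)) (pi / 2 * x).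
have mn0 : m%:R != 0 :> R by rewrite pnatr_eq0 -lt0n.
have pim := @pim_gt0 R m m1.
have pi2 := @pi2_gt0 R.
have pt y : 0 <= y <= 1 -> \sum_(s < n) c s * G s * azim b (ks s) (pi * y) = 0.
  move=> /andP[y0 y1]; rewrite -[RHS](H (sph (pi / 2 * x, pi / m%:R * y))).
    apply: eq_bigr => s _.
    have /= -> := congr1 (fun h : R * R -> R => h (pi / 2 * x, pi / m%:R * y))
      (mode_sph b (m * ks s) (gegen (m * ks s) (parity e) (i_ s))).
    rewrite -mulrA; congr (_ * (_ * _)); rewrite /azim natrM.
    have -> : m%:R * (ks s)%:R * (pi / m%:R * y) = (ks s)%:R * (pi * y) by field.
    by [].
  exists (pi / 2 * x, pi / m%:R * y) => //=.
  by case/andP: x01 => x0 x1; split; apply/andP; split=> /=; nra.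
have E : \sum_(s < n) c s * G s *
    int01 (fun y => azim b (ks j) (pi * y) * azim b (ks s) (pi * y)) = 0.
  rewrite (int01_sum _ (fun s => c s * G s)).
    rewrite -[RHS](int01_cst (0 : R)); apply: eq_int01 => y y01.
    by rewrite pt// mulr0.
  - by have cj := cA (ks j); cont.
  - by move=> s; have cj := cA (ks s); cont.
move: E; rewrite (bigD1 j)//= big1 ?addr0; last first.
  move=> s sj; rewrite azim_orthogonal ?mulr0//.
  by apply: contra_neq sj => /iks.
move/eqP; rewrite /G mulf_eq0 mulf_eq0 (negPf nx) (gt_eqF (azim_norm_gt0 (kks j))) !orbF.
by move/eqP.
Qed.

End ModesAreEigenfunctions.

(** * Multiplicities and the counting function *)

Section Multiplicity.
Context {R : realType}.
Implicit Types (p : {poly R}) (k m n : nat) (b e : bc) (l t : R).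

Lemma cont_eigenfunction_sph m b e l u :
  eigenfunction m b e l u -> continuous (u \o @sph R).
Proof. by move=> [[/= du _] _ _ _ _]; apply: cont_C1_sph => q; exact: du. Qed.

Lemma pairing_sum m b k p N (c : 'I_N -> R) (f : 'I_N -> 'rV[R]_3 -> R) :
  (forall i, continuous (f i \o @sph R)) ->
  pairing m b k p (fun P => \sum_(i < N) c i * f i P) =
  \sum_(i < N) c i * pairing m b k p (f i).
Proof.
move=> cf; have cA := @cont_azim R b k; have cP := @cont_polar R k p.
pose H i x := int01 (fun y => azim b k (pi / m%:R * y) *
    (sin (pi / 2 * x) * polar k p (pi / 2 * x) *
     (f i \o @sph R) (pi / 2 * x, pi / m%:R * y))).
have cH i : continuous (H i).
  apply: (cont_int01 (F := fun x y => azim b k (pi / m%:R * y) *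
    (sin (pi / 2 * x) * polar k p (pi / 2 * x) *
     (f i \o @sph R) (pi / 2 * x, pi / m%:R * y)))).
  set g := f i \o _; have cg : continuous g := cf i.
  by cont.
transitivity (\sum_(i < N) c i * int01 (fun x => 1 * H i x)); last first.
  by apply: eq_bigr => i _; congr (_ * _); apply: eq_int01 => x _; rewrite mul1r.
rewrite int01_sum//; last exact: contC.
apply: eq_int01 => x _; rewrite mul1r.
pose w y := azim b k (pi / m%:R * y) * (sin (pi / 2 * x) * polar k p (pi / 2 * x)).
transitivity (\sum_(i < N) c i *
    int01 (fun y => w y * (f i \o @sph R) (pi / 2 * x, pi / m%:R * y))).
  rewrite int01_sum.
  - by apply: eq_int01 => y _; rewrite /w mulrA.
  - by rewrite /w; cont.
  - move=> i; set g := f i \o _; have cg : continuous g := cf i.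
    by cont.
apply: eq_bigr => i _; congr (_ * _); apply: eq_int01 => y _.
by rewrite /w -mulrA.
Qed.

(** With more eigenfunctions than modes, some nontrivial combination would be
    orthogonal to all modes of the eigenvalue [l]; it is orthogonal to the other
    modes anyway, so vanishes by completeness. *)
Lemma lin_indep_le m b e l (ms : seq (nat * nat)) N (f : 'I_N -> 'rV[R]_3 -> R) :
  (1 <= m)%N ->
  (forall k i, (kmin b <= k)%N -> sph_eig (m * k + parity e + 2 * i) = l ->
    (k, i) \in ms) ->
  (forall i, eigenfunction m b e l (f i)) -> lin_indep_on (@half_lune R m) f ->
  (N <= size ms)%N.
Proof.
move=> m1 hms hf lf; rewrite leqNgt; apply/negP => sN.
pose mp (d : nat * nat) := gegen (m * d.1) (parity e) d.2 : {poly R}.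
pose B : 'M[R]_(N, size ms) := \matrix_(i, j)
  pairing m b (m * (nth (0, 0)%N ms j).1) (mp (nth (0, 0)%N ms j)) (f i).
have kB : kermx B != 0.
  rewrite -mxrank_eq0 mxrank_ker subn_eq0 -ltnNge.
  exact: leq_ltn_trans (rank_leq_col B) sN.
have [c c0 cB] : exists2 c : 'rV[R]_N, c != 0 & c *m B = 0.
  exists (nz_row (kermx B)); first by rewrite nz_row_eq0.
  by apply/sub_kermxP; exact: nz_row_sub.
have cf i : continuous (f i \o @sph R) by exact: cont_eigenfunction_sph (hf i).
pose u P := \sum_(i < N) c 0 i * f i P.
have cu : continuous (u \o @sph R).
  rewrite (_ : _ \o _ = fun q => \sum_(i < N) c 0 i * (f i \o @sph R) q)//.
  by apply: cont_sum => i; apply: contM; [exact: contC|exact: cf].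
have u0 : forall q, half_lune m q -> u q = 0.
  apply: (modes_complete (b := b) (e := e)) => // k i kk.
  rewrite pairing_sum//.
  have [E|E] := eqVneq (sph_eig (m * k + parity e + 2 * i)) l.
    have ki := hms _ _ kk E.
    have ji : (index (k, i) ms < size ms)%N by rewrite index_mem.
    have := congr1 (fun M : 'rV_(size ms) => M 0 (Ordinal ji)) cB.
    rewrite !mxE => E0; rewrite -[RHS]E0; apply: eq_bigr => s _.
    by rewrite !mxE /= nth_index.
  apply: big1 => s _.
  by rewrite (eigenfunction_orthogonal m1 (hf s) (gegen_eq _ _ _)
    (gegen_equator_bc _ _ _) E) ?mulr0// parity_le1.
have := lf (fun i => c 0 i) u0 => c00.
by move/eqP: c0; apply; apply/rowP => i; rewrite mxE; exact: c00.
Qed.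

(** The indices [k] of the modes of degree [n]; the index [i] is determined by
    [n = m * k + parity e + 2 * i]. *)
Definition degree_modes m b e n : seq nat :=
  [seq k <- iota 0 n.+1 | [&& (kmin b <= k)%N, (m * k + parity e <= n)%N &
    ~~ odd (n - (m * k + parity e))]].

Lemma multiplicityE m b e l d :
  (forall N (f : 'I_N -> 'rV[R]_3 -> R), (forall i, eigenfunction m b e l (f i)) ->
    lin_indep_on (@half_lune R m) f -> (N <= d)%N) ->
  (exists f : 'I_d -> 'rV[R]_3 -> R, (forall i, eigenfunction m b e l (f i)) /\
    lin_indep_on (@half_lune R m) f) ->
  multiplicity m b e l = d%:R%:E.
Proof.
move=> Hle Hex; apply/eqP; rewrite eq_le; apply/andP; split.
  apply: ge_ereal_sup => _ [N [f [hf lf]] <-].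
  by rewrite lee_fin ler_nat; exact: Hle hf lf.
by apply: ereal_sup_ubound; exists d.
Qed.

Lemma multiplicity_sph_eig m b e n : (1 <= m)%N ->
  multiplicity m b e (sph_eig n : R) = (size (degree_modes m b e n))%:R%:E.
Proof.
move=> m1; set ks := degree_modes m b e n.
pose i_ k := ((n - (m * k + parity e))./2)%N.
have ksP k : k \in ks -> (kmin b <= k)%N /\ n = (m * k + parity e + 2 * i_ k)%N.
  rewrite mem_filter => /andP[/and3P[kk kn odd0] _]; split=> //.
  rewrite mul2n /i_ -[LHS](subnKC kn) -[X in (_ + X)%N = _]odd_double_half.
  by rewrite (negPf odd0).
apply: multiplicityE.
  move=> N f hf lf; rewrite -(size_map (fun k => (k, i_ k))).
  apply: (lin_indep_le m1 _ hf lf) => k i kk /sph_eig_inj En.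
  apply/mapP; exists k; last by rewrite /i_ -En addKn mul2n doubleK.
  rewrite mem_filter kk -En leq_addr addKn mul2n odd_double mem_iota /=.
  by have := leq_pmull k m1; lia.
pose kj (j : 'I_(size ks)) := nth 0%N ks j.
have kjin j : kj j \in ks by exact: mem_nth.
exists (fun j => mode b (m * kj j) (gegen (m * kj j) (parity e) (i_ (kj j)))).
split=> [j|].
  have [_ {1}->] := ksP _ (kjin j).
  by apply: mode_eigenfunction; [|exact/gegen_eq/parity_le1|exact: gegen_equator_bc].
apply: modes_lin_indep => // [|j]; last by have [] := ksP _ (kjin j).
move=> j j' /eqP; rewrite nth_uniq//; first by move/eqP/val_inj.
by rewrite filter_uniq// iota_uniq.
Qed.

Lemma multiplicity_other m b e l : (1 <= m)%N -> (forall n, l != sph_eig n) ->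
  multiplicity m b e l = 0%E.
Proof.
move=> m1 hl; rewrite (@multiplicityE m b e l 0)//.
  move=> N f hf lf; apply: (@lin_indep_le m b e l [::] _ _ m1 _ hf lf) => k i _ E.
  by have := hl (m * k + parity e + 2 * i)%N; rewrite E eqxx.
exists (fun _ _ => 0); split; first by case.
by move=> c _ [].
Qed.

Lemma countingE m b e t N : (1 <= m)%N ->
  (forall n, sph_eig n <= t -> (n < N)%N) ->
  Defs.counting m b e t =
  \sum_(n < N) (size (degree_modes m b e n))%:R * (sph_eig n <= t)%R%:R.
Proof.
move=> m1 hN; rewrite /Defs.counting.
pose D n : R := (size (degree_modes m b e n))%:R.
have mE l : l <= t -> multiplicity m b e l =
    (\sum_(n < N) (if l \in [set sph_eig n : R] then (D n)%:E else 0%E))%E.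
  move=> lt; have [[n nl]|H] := pselect (exists n, l = sph_eig n).
    have nN : (n < N)%N by apply: hN; rewrite -nl.
    rewrite nl multiplicity_sph_eig// (bigD1 (Ordinal nN))//= mem_set//.
    rewrite big1 ?adde0// => j jn; rewrite memNset// => /sph_eig_inj E.
    by move: jn; rewrite -val_eqE /= -E eqxx.
  rewrite multiplicity_other//.
    by rewrite big1// => j _; rewrite memNset// => E; apply: H; exists j.
  by move=> n; apply/eqP => E; apply: H; exists n.
rewrite (@eq_esum R R _ _ _ mE) esum_sum; last first.
  by move=> l n _ _; case: ifP => // _; rewrite lee_fin ler0n.
rewrite (eq_bigr (fun n : 'I_N => (D n * (sph_eig n <= t)%R%:R)%:E)); last first.
  move=> n _; rewrite -esum_mkcondr.
  have [le|gt] := boolP (sph_eig n <= t).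
    rewrite (_ : _ `&` _ = [set sph_eig n : R]).
      by rewrite esum_set1 ?mulr1// lee_fin ler0n.
    by apply/seteqP; split=> l /=; [case|move=> ->].
  rewrite (_ : _ `&` _ = set0) ?esum_set0 ?mulr0//.
  by apply/seteqP; split=> l //= [/[swap] ->]; rewrite (negPf gt).
by rewrite sumEFin.
Qed.

End Multiplicity.

(** * The periodic function *)

Section Beta.
Context {R : realType}.
Implicit Types (x y c : R).

Definition bump y : R :=
  (y - (Num.floor y)%:~R) * (1 - (y - (Num.floor y)%:~R)).

Lemma bumpE y (n : int) : n%:~R <= y <= n%:~R + 1 ->
  bump y = (y - n%:~R) * (1 - (y - n%:~R)).
Proof.
move=> /andP[ny]; rewrite le_eqVlt => /predU1P[->|yn].
  by rewrite /bump (_ : Num.floor _ = n + 1) ?intrD ?intr1; [ring|apply: floor_def; rewrite !intrD lexx ltrDl/=].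
by rewrite /bump (_ : Num.floor y = n)//; apply: floor_def; rewrite ny intrD.
Qed.

(** [bump] is the maximum of these parabolas; its continuity follows. *)
Lemma bump_ge y (n : int) : (y - n%:~R) * (1 - (y - n%:~R)) <= bump y.
Proof.
rewrite /bump; set k := Num.floor y.
have /andP[ky yk] := floor_itv y; rewrite -/k intrD in ky yk.
have : (n <= k - 1) || (n == k) || (k + 1 <= n) by lia.
case/orP => [/orP[nk|/eqP->//]|nk].
  have : n%:~R <= (k - 1)%:~R :> R by rewrite ler_int.
  rewrite intrD intrN; nra.
have : (k + 1)%:~R <= n%:~R :> R by rewrite ler_int.
rewrite intrD; nra.
Qed.

Lemma bump_itv y : 0 <= bump y <= 1.
Proof.
rewrite /bump; have /andP[] := floor_itv y; rewrite intrD.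
set k := (Num.floor y)%:~R : R => ky yk; apply/andP; split; nra.
Qed.

Lemma bump_lip x y : bump x - bump y <= `|x - y| * (1 + `|x - y|).
Proof.
have := bump_ge y (Num.floor x); rewrite {2}/bump.
have /andP[] := floor_itv x; rewrite intrD.
set k := (Num.floor x)%:~R : R => kx xk H.
by have [xy|xy] := lerP y x; nra.
Qed.

Lemma cont_bump : continuous bump.
Proof.
move=> x; apply/cvgrPdist_le => e e0.
have e1 : 0 < Num.min 1 (e / 2) by rewrite lt_min ltr01 divr_gt0.
apply/nbhs_ballP; exists (Num.min 1 (e / 2)) => //= y.
rewrite /ball /= lt_min => /andP[h1 h2].
have H1 := bump_lip x y; have H2 := bump_lip y x.
rewrite [`|y - x|]distrC in H2.
have : `|x - y| * (1 + `|x - y|) <= e by have := normr_ge0 (x - y); nra.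
by rewrite ler_norml; move=> H3; apply/andP; split; lra.
Qed.

(** The second periodic Bernoulli function, up to scaling: for [y] in [0, 1],
    [beta (2 * y)] is [-2 * (y ^ 2 - y + 1 / 6)]. *)
Definition beta x : R := 2 * bump (x / 2) - 1 / 3.

Lemma cont_beta : continuous beta.
Proof. by have cb := cont_bump; rewrite /beta; cont. Qed.

Lemma beta_norm x : `|beta x| <= 2.
Proof. by rewrite /beta; have /andP[] := bump_itv (x / 2); rewrite ler_norml; move=> *; apply/andP; split; lra. Qed.

Lemma betaE x (n : int) : 2 * n%:~R <= x <= 2 * n%:~R + 2 ->
  beta x = (x - 2 * n%:~R) * (2 - (x - 2 * n%:~R)) / 2 - 1 / 3.
Proof.
move=> /andP[h1 h2]; rewrite /beta (@bumpE _ n); first by field.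
by apply/andP; split; lra.
Qed.

Lemma beta_int x (n : int) : beta (x + 2 * n%:~R) = beta x.
Proof.
have /andP[h1 h2] := floor_itv (x / 2); rewrite intrD in h2.
rewrite (@betaE x (Num.floor (x / 2))); last by apply/andP; split; lra.
rewrite (@betaE _ (Num.floor (x / 2) + n)); last by rewrite intrD; apply/andP; split; lra.
by rewrite intrD; field.
Qed.

(** On [0, c] and on [c, 2], [beta (x - c)] is a polynomial. *)
Lemma beta_mean_itv c : 0 < c < 2 ->
  \int[lebesgue_measure]_(x in `[0, 2]) beta (x - c) = 0.
Proof.
move=> /andP[c0 c2].
have cbc : continuous (fun x => beta (x - c)) by have cb := cont_beta; cont.
have ib (a b : R) : (@lebesgue_measure R).-integrable `[a, b]
    (EFin \o (fun x => beta (x - c))).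
  apply: continuous_compact_integrable; first exact: segment_compact.
  exact: continuous_subspaceT.
have dpoly (d z : R) : is_derive z 1
    (fun x => (x - d) ^+ 2 / 2 - (x - d) ^+ 3 / 6 - (x - d) / 3)
    ((z - d) * (2 - (z - d)) / 2 - 1 / 3).
  have D1 : is_derive z 1 (fun x : R => x - d) 1 by apply: is_derive_eq; rewrite subr0.
  have D n : is_derive z 1 (fun x : R => (x - d) ^+ n) (n%:R * (z - d) ^+ n.-1).
    have D2 : is_derive (z - d) 1 (fun y : R => y ^+ n) (n%:R * (z - d) ^+ n.-1).
      apply: DeriveDef; first exact: exprn_derivable.
      by rewrite exp_derive [_ *: _]mulr1.
    by rewrite -[X in is_derive _ _ _ X]mulr1; exact: (is_derive_chain (g := fun x : R => x - d) D2 D1).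
  have D2 := D 2%N; have D3 := D 3%N.
  by apply: is_derive_eq; rewrite /GRing.scale/=; field.
have part (d a b : R) (n : int) : a < b -> d = c + 2 * n%:~R -> d <= a -> b <= d + 2 ->
    \int[lebesgue_measure]_(x in `[a, b]) beta (x - c) =
    ((b - d) ^+ 2 / 2 - (b - d) ^+ 3 / 6 - (b - d) / 3) -
    ((a - d) ^+ 2 / 2 - (a - d) ^+ 3 / 6 - (a - d) / 3).
  move=> ab dE da bd.
  transitivity (\int[@lebesgue_measure R]_(x in `[a, b])
      ((x - d) * (2 - (x - d)) / 2 - 1 / 3)); last first.
    apply: (Rintegral_FTC (F := fun x => (x - d) ^+ 2 / 2 - (x - d) ^+ 3 / 6 - (x - d) / 3)) => //.
      by cont.
    by move=> x _; apply: differentiable_continuous; apply/derivable1_diffP; case: (dpoly d x).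
  apply: eq_Rintegral => x; rewrite inE/= in_itv/= => /andP[ax xb].
  rewrite (@betaE _ n); first by rewrite dE; field.
  by apply/andP; split; lra.
have := Rintegral_itvB (ib 0 2) (x := c).
rewrite !bnd_simp => /(_ (ltW c0) (ltW c2)).
rewrite Rintegral_itv_obnd_cbnd; last first.
  apply: integrableS (ib c 2) => //.
  by move=> x /=; rewrite !in_itv/= => /andP[/ltW -> ->].
rewrite (part (c - 2) 0 c (-1)) ?(part c c 2 0)//; try lra.
Qed.

Lemma beta_mean (n : nat) :
  \int[lebesgue_measure]_(x in `[0, 2]) beta (x - (n%:R + 1 / 2)) = 0.
Proof.
rewrite -[RHS](@beta_mean_itv ((odd n)%:R + 1 / 2)); last first.
  by case: (odd n); rewrite /=; apply/andP; split; lra.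
apply: eq_Rintegral => x _.
rewrite -{1}(odd_double_half n) natrD -muln2 natrM.
rewrite -[LHS](beta_int _ (n./2)%:Z); congr beta.
by rewrite -pmulrn; ring.
Qed.

End Beta.

(** * Asymptotics of the lattice sum *)

Section LatticeSum.
Context {R : realType}.
Implicit Types (s a z M : R) (m k i n N : nat) (b e : bc).

(** The nonoscillating part of [row_sum], by Euler-Maclaurin summation. *)
Definition row_main s a : R :=
  s ^+ 3 / 3 + s ^+ 2 / 2 - (s ^+ 2 * a / 2 - a ^+ 3 / 6 + a ^+ 2 / 2 - a / 3).

Definition row_sum N s a : R :=
  \sum_(i < N) Num.max 0 (s ^+ 2 - (a + 2 * i%:R) ^+ 2).

Lemma row_sum_eq0 N s a : 0 <= s -> s < a -> row_sum N s a = 0.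
Proof.
move=> s0 sa; apply: big1 => i _; apply/max_idPl.
by have := ler0n R i; nra.
Qed.

(** The polynomial [Q] satisfies [Q (x + 2) - Q x = s ^ 2 - x ^ 2], so the sum is
    [Q] at the first point [a + 2 * I + 2] of the row beyond [s], minus [Q a].
    Expanding [Q] at [s] gives a cubic in [s], the term in [beta] and a bounded
    remainder. *)
Lemma row_sumE N s a : 0 <= a <= s ->
  (forall i, a + 2 * i%:R <= s -> (i < N)%N) ->
  `|row_sum N s a - (row_main s a + s * beta (s - a))| <= 1.
Proof.
move=> /andP[a0 sa] hN.
pose I := Num.truncn ((s - a) / 2).
have /andP[I1 I2] : I%:R <= (s - a) / 2 < I.+1%:R.
  by apply: truncn_itv; rewrite divr_ge0// subr_ge0.
have {}I1 : a + 2 * I%:R <= s by lra.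
have {}I2 : s < a + 2 * I%:R + 2 by rewrite -[I.+1%:R]natr1 in I2; lra.
have IN : (I.+1 <= N)%N by exact: hN.
pose Q x := s ^+ 2 * x / 2 - x ^+ 3 / 6 + x ^+ 2 / 2 - x / 3.
have closed J : \sum_(0 <= i < J) (s ^+ 2 - (a + 2 * i%:R) ^+ 2) =
    Q (a + 2 * J%:R) - Q a.
  elim: J => [|J IH]; first by rewrite big_geq// mulr0 addr0 subrr.
  by rewrite big_nat_recr//= IH -[J.+1%:R]natr1 /Q; field.
have -> : row_sum N s a = Q (a + 2 * I.+1%:R) - Q a.
  rewrite -closed /row_sum.
  rewrite -(big_mkord xpredT (fun i => Num.max 0 (s ^+ 2 - (a + 2 * i%:R) ^+ 2))).
  rewrite (big_cat_nat (leq0n _) IN)//= [X in _ + X]big1_seq ?addr0; last first.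
    move=> i /=; rewrite mem_index_iota => /andP[Ii _]; apply/max_idPl.
    have : I%:R + 1 <= i%:R :> R by rewrite natr1 ler_nat.
    nra.
  apply: eq_big_seq => i; rewrite mem_index_iota /= => iI.
  apply/max_idPr; rewrite subr_ge0.
  have : i%:R <= I%:R :> R by rewrite ler_nat -ltnS.
  have := ler0n R i; nra.
rewrite (@betaE _ _ I%:Z) -?pmulrn; last by apply/andP; split; lra.
pose v := a + 2 * I%:R + 2 - s.
have v0 : 0 < v by rewrite /v; lra.
have v2 : v <= 2 by rewrite /v; lra.
have -> : Q (a + 2 * I.+1%:R) - Q a - (row_main s a + s *
    ((s - a - 2 * I%:R) * (2 - (s - a - 2 * I%:R)) / 2 - 1 / 3)) =
    - v * (v - 1) * (v - 2) / 6.
  by rewrite /Q /row_main /v -[I.+1%:R]natr1; field.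
by rewrite ler_norml; apply/andP; split; nra.
Qed.

Lemma sum_alternate N (x : nat -> R) (y0 y1 : R) :
  (forall k, x k = if odd k then y1 else y0) ->
  \sum_(k < N) x k = N%:R / 2 * (y0 + y1) + (odd N)%:R * ((y0 - y1) / 2).
Proof.
move=> hx; elim: N => [|N IH]; first by rewrite big_ord0 !mul0r addr0.
by rewrite big_ord_recr IH /= hx -[N.+1%:R]natr1; case: (odd N); rewrite /=; field.
Qed.

(** The sum of [row_main s (al + M * k)] over [k < L], as a polynomial in [L], to
    be evaluated at real [L]; [A1], [A2], [A3] are the sums of the powers of
    [al + M * k]. *)
Definition main_sum M al s (L : R) : R :=
  let S1 := L * (L - 1) / 2 in
  let S2 := L * (L - 1) * (2 * L - 1) / 6 in
  let S3 := (L * (L - 1) / 2) ^+ 2 in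
  let A1 := L * al + M * S1 in
  let A2 := L * al ^+ 2 + 2 * al * M * S1 + M ^+ 2 * S2 in
  let A3 := L * al ^+ 3 + 3 * al ^+ 2 * M * S1 + 3 * al * M ^+ 2 * S2 + M ^+ 3 * S3 in
  L * (s ^+ 3 / 3 + s ^+ 2 / 2) - (s ^+ 2 * A1 / 2 - A3 / 6 + A2 / 2 - A1 / 3).

Lemma main_sumE M al s N :
  \sum_(k < N) row_main s (al + M * k%:R) = main_sum M al s N%:R.
Proof.
elim: N => [|N IH]; first by rewrite big_ord0 /main_sum; field.
by rewrite big_ord_recr IH /= -[N.+1%:R]natr1 /main_sum /row_main; field.
Qed.

(** A mode of degree [n] counts when [n + 1 / 2 <= s]; this is the least value of
    [n + 1 / 2 - m * k]. *)
Definition offset e : R := (parity e)%:R + 1 / 2.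

(** The coefficients of [sqrt (t + 1 / 4)] and of 1 in [counting_approx]. *)
Definition approx1 b e M : R :=
  match b, e with
  | Neumann, Neumann => 1 / 4 + 1 / (4 * M)
  | Neumann, Dirichlet => 1 / 4 - 1 / (4 * M)
  | Dirichlet, Neumann => - (1 / 4) + 1 / (4 * M)
  | Dirichlet, Dirichlet => - (1 / 4) - 1 / (4 * M)
  end.
Definition approx0 b e M : R :=
  1 / 24 * (M - 1 / M) + 1 / (12 * M) +
  match b, e with
  | Neumann, Neumann | Dirichlet, Dirichlet => 1 / 8
  | _, _ => - (1 / 8)
  end.

(** The integral of [counting_approx] from 0 to [t = s ^ 2 - 1 / 4]. *)
Definition approx_int b e M s : R :=
  let t := s ^+ 2 - 1 / 4 in
  t ^+ 2 / (8 * M) + approx1 b e M * (2 / 3) * (s ^+ 3 - 1 / 8) + approx0 b e M * t.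

(** The nonoscillating part of the error.  The number of rows [k] that reach below
    [s] is [(s - offset e) / M + z] with [z] in [0, 1]; the row of index 0 is
    absent for Dirichlet conditions on the meridians. *)
Definition main_error b e M z s : R :=
  main_sum M (offset e) s ((s - offset e) / M + z)
  - (if b is Neumann then 0 else row_main s (offset e)) - approx_int b e M s.

(** The coefficients in [counting_approx] are the right ones: the terms of degree
    4, 3 and 2 in [s] cancel, whatever [z] is.  An affine function of [s] is
    determined by its values at 0 and 1, and this form avoids writing out the
    remaining coefficients. *)
Lemma main_error_affine b e M z s : M != 0 ->
  main_error b e M z s =
  s * (main_error b e M z 1 - main_error b e M z 0) + main_error b e M z 0.
Proof.
move=> M0; rewrite /main_error /main_sum /row_main /approx_int /approx1 /approx0 /offset.
by case: b; case: e => /=; field.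
Qed.

(** The periodic function of the theorem, as a function of [s]. *)
Definition fluctuation e M s : R :=
  (beta (s - offset e) + beta (s - offset e - M)) / (2 * M).

(** The integral of the counting function from 0 to [s ^ 2 - 1 / 4], when [N]
    exceeds all degrees that count. *)
Definition lattice_sum m b e N s : R :=
  \sum_(k < N | (kmin b <= k)%N) row_sum N s (offset e + m%:R * k%:R).

Lemma beta_row m k e s :
  beta (s - (offset e + m%:R * k%:R)) =
  if odd k then beta (s - offset e - m%:R) else beta (s - offset e).
Proof.
rewrite -(beta_int _ (m * k./2)%N%:Z) -pmulrn natrM.
rewrite -[in m%:R * k%:R](odd_double_half k) natrD -muln2 natrM.
by case: (odd k) => /=; congr beta; ring.
Qed.

(** The rows of even and of odd index have two constant values of [beta]; with
    [L] rows, [L = s / M + O(1)], their contribution is [s * L / 2] times the sum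
    of these values. *)
Lemma lattice_sum_asymp m b e : (1 <= m)%N -> exists2 C : R, 0 <= C &
  forall N s, offset e <= s -> (forall n, n%:R + 1 / 2 <= s -> (n < N)%N) ->
    `|lattice_sum m b e N s - approx_int b e m%:R s
      - (s ^+ 2 - 1 / 4) * fluctuation e m%:R s| <= C * s.
Proof.
move=> m1; set M : R := m%:R.
have M1 : 1 <= M by rewrite ler1n.
have M0 : M != 0 by rewrite gt_eqF//; lra.
set al := offset e.
have [al1 al2] : 1 / 2 <= al /\ al <= 3 / 2.
  by rewrite /al /offset; case: (e) => /=; split; lra.
have cE s : continuous (fun z => main_error b e M z s).
  rewrite /main_error /main_sum; cont.
have [B1 B10 HB1] := bounded01 (cE 1).
have [B0 B00 HB0] := bounded01 (cE 0).
exists (B1 + 3 * B0 + 20); first by lra.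
move=> N s als hN.
pose L := (Num.truncn ((s - al) / M)).+1.
have /andP[L1 L2] : (L.-1)%:R <= (s - al) / M < L%:R.
  by apply: truncn_itv; rewrite divr_ge0//; lra.
pose z := L%:R - (s - al) / M.
have LE : L%:R = (s - al) / M + z by rewrite /z; ring.
have LL : L%:R = (L.-1)%:R + 1 :> R by rewrite natr1.
have z01 : 0 <= z <= 1 by rewrite /z LL; apply/andP; split; lra.
have rowle k : (k < L)%N -> al + M * k%:R <= s.
  move=> kL; have : k%:R <= (L.-1)%:R :> R by rewrite ler_nat -ltnS.
  have : (L.-1)%:R * M <= s - al by rewrite -ler_pdivlMr//; lra.
  nra.
have LN : (L <= N)%N.
  have := rowle L.-1 (ltnSn _); rewrite /al /offset => H.
  have : (parity e + m * L.-1 < N)%N.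
    by apply: hN; rewrite natrD natrM -/M; lra.
  apply: leq_ltn_trans; exact: leq_trans (leq_pmull _ m1) (leq_addl _ _).
have Lpos : (0 < L)%N by [].
pose Phi k := row_sum N s (al + M * k%:R).
pose b0 := beta (s - al); pose b1 := beta (s - al - M).
have PhiE k : (k < L)%N ->
    `|Phi k - (row_main s (al + M * k%:R) + s * beta (s - (al + M * k%:R)))| <= 1.
  move=> kL; apply: row_sumE.
    by rewrite rowle// andbT addr_ge0 ?mulr_ge0 ?ler0n//; lra.
  move=> i hi; have : (parity e + m * k + 2 * i < N)%N.
    by apply: hN; move: hi; rewrite /al /offset !natrD !natrM -/M; lra.
  apply: leq_ltn_trans; exact: leq_trans (leq_pmull i (isT : 0 < 2)%N) (leq_addl _ _).
have SL : \sum_(k < N) Phi k = \sum_(k < L) Phi k.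
  rewrite -!(big_mkord xpredT Phi) (big_cat_nat (leq0n _) LN)//= [X in _ + X]big1_seq ?addr0//.
  move=> k /=; rewrite mem_index_iota => /andP[Lk _].
  apply: row_sum_eq0; first by lra.
  have : L%:R <= k%:R :> R by rewrite ler_nat.
  have : s - al < L%:R * M by rewrite -ltr_pdivrMr//; lra.
  nra.
pose e1 := \sum_(k < L) Phi k -
  \sum_(k < L) (row_main s (al + M * k%:R) + s * beta (s - (al + M * k%:R))).
have He1 : `|e1| <= L%:R.
  rewrite /e1 -sumrB; apply: (le_trans (ler_norm_sum _ _ _)).
  rewrite -[leRHS]mulr1 mulr_natl -[X in _ *+ X]card_ord -sumr_const.
  by apply: ler_sum => k _; exact: PhiE.
pose e0 := if b is Neumann then 0 else Phi 0%N - (row_main s al + s * b0).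
have He0 : `|e0| <= 1.
  rewrite /e0; case: (b); first by rewrite normr0.
  by have := PhiE 0%N Lpos; rewrite mulr0 addr0.
have SE : lattice_sum m b e N s = \sum_(k < N) Phi k -
    (if b is Neumann then 0 else Phi 0%N).
  rewrite /lattice_sum; case: (b) => /=; first by rewrite subr0.
  have [N' NE] : exists N', N = N'.+1 by exists N.-1; rewrite prednK// (leq_trans Lpos).
  rewrite /Phi NE big_mkcond [X in _ = X - _]big_ord_recl big_ord_recl /= add0r.
  by rewrite addrC addKr; apply: eq_bigr => k _.
have B : \sum_(k < L) beta (s - (al + M * k%:R)) =
    L%:R / 2 * (b0 + b1) + (odd L)%:R * ((b0 - b1) / 2).
  apply: (@sum_alternate L (fun k => beta (s - (al + M * k%:R)))) => k.
  exact: beta_row.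
have main : lattice_sum m b e N s - approx_int b e M s
      - (s ^+ 2 - 1 / 4) * fluctuation e M s =
   main_error b e M z s + s * ((z - al / M) / 2 * (b0 + b1)) + (b0 + b1) / (8 * M)
   + s * ((odd L)%:R * ((b0 - b1) / 2)) + e1 - e0
   - s * (if b is Neumann then 0 else b0).
  rewrite SE SL /fluctuation -/al -/b0 -/b1 /main_error -/al -LE -main_sumE.
  have -> : \sum_(k < L) Phi k = e1 + (\sum_(k < L) row_main s (al + M * k%:R) +
      s * (L%:R / 2 * (b0 + b1) + (odd L)%:R * ((b0 - b1) / 2))).
    by rewrite /e1 big_split /= -mulr_sumr B; ring.
  rewrite LE /e0; case: (b); by field.
rewrite main.
clear main SE SL B PhiE rowle hN LN.
have s0 : 1 / 2 <= s by lra.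
have Hb0 := beta_norm (s - al); rewrite -/b0 in Hb0.
have Hb1 := beta_norm (s - al - M); rewrite -/b1 in Hb1.
have bnd (x y : R) : `|x| <= y -> `|s * x| <= y * s.
  have s00 : 0 <= s by lra.
  by move=> xy; rewrite normrM (ger0_norm s00) [y * s]mulrC ler_wpM2l.
have T0 : `|main_error b e M z s| <= (B1 + 3 * B0) * s.
  rewrite main_error_affine//; apply: (le_trans (ler_normD _ _)).
  have H1 := HB1 z z01; have H0 := HB0 z z01.
  have : `|s * (main_error b e M z 1 - main_error b e M z 0)| <= (B1 + B0) * s.
    by apply: bnd; apply: (le_trans (ler_normB _ _)); lra.
  nra.
have T1 : `|s * ((z - al / M) / 2 * (b0 + b1))| <= 6 * s.
  apply: bnd; rewrite normrM.
  have H1 : `|b0 + b1| <= 4 by apply: (le_trans (ler_normD _ _)); lra.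
  have H2 : `|(z - al / M) / 2| <= 3 / 2.
    have : 0 <= al / M by rewrite divr_ge0//; lra.
    have : al / M <= 3 / 2 by rewrite ler_pdivrMr; lra.
    by case/andP: z01 => z0 z1 h1 h2; rewrite ler_norml; apply/andP; split; lra.
  have := normr_ge0 (b0 + b1); have := normr_ge0 ((z - al / M) / 2); nra.
have T2 : `|(b0 + b1) / (8 * M)| <= s.
  rewrite normrM.
  have H1 : `|b0 + b1| <= 4 by apply: (le_trans (ler_normD _ _)); lra.
  have H2 : `|(8 * M)^-1| <= 1 / 8.
    rewrite ger0_norm ?invr_ge0; last by lra.
    rewrite div1r lef_pV2 ?posrE; lra.
  have := normr_ge0 (b0 + b1); have := normr_ge0 ((8 * M)^-1); nra.
have T3 : `|s * ((odd L)%:R * ((b0 - b1) / 2))| <= 2 * s.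
  apply: bnd; rewrite ler_norml; move: Hb0 Hb1; rewrite !ler_norml.
  by move=> /andP[? ?] /andP[? ?]; case: (odd L); rewrite /=; apply/andP; split; lra.
have T4 : `|s * (if b is Neumann then 0 else b0)| <= 2 * s.
  by apply: bnd; case: (b); rewrite ?normr0.
have T5 : L%:R <= s + 1.
  have : (s - al) / M <= s by rewrite ler_pdivrMr; nra.
  by rewrite LL; lra.
move: T0 T1 T2 T3 T4 He1 He0; rewrite !ler_norml.
set X0 := main_error _ _ _ _ _; set X1 := s * _; set X2 := _ / (8 * M).
set X3 := s * _; set X4 := s * _.
by do 7 move=> /andP[? ?]; apply/andP; split; lra.
Qed.

End LatticeSum.

(** * Integrating the counting function *)

Section Integration.
Context {R : realType}.
Implicit Types (t s : R) (m k i n N : nat) (b e : bc).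
Notation mu := (@lebesgue_measure R).

(** A step of height [D n] at [c n] contributes [D n * (t - c n)]. *)
Lemma Rintegral_steps N (D c : nat -> R) t : (forall n, 0 <= c n) ->
  mu.-integrable `[0, t] (EFin \o (fun x => \sum_(n < N) D n * (c n <= x)%R%:R)) /\
  \int[mu]_(x in `[0, t]) (\sum_(n < N) D n * (c n <= x)%R%:R) =
  \sum_(n < N) D n * Num.max 0 (t - c n).
Proof.
move=> c0.
have stepE n x : x \in `[0, t]%classic -> (c n <= x)%R%:R = \1_(`[c n, t]) x :> R.
  rewrite inE /= in_itv/= => /andP[_ xt].
  by rewrite indicE; congr ((nat_of_bool _)%:R); apply/idP/idP;
    [move=> cx; rewrite inE /= in_itv/= cx|rewrite inE /= in_itv/= => /andP[]].
have int1 n : mu.-integrable `[0, t] (EFin \o \1_(`[c n, t])).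
  apply: (@integrableS _ _ _ _ setT) => //; exact: integrable_indic_itv.
have step n : mu.-integrable `[0, t] (EFin \o (fun x => (c n <= x)%R%:R : R)).
  apply: eq_integrable (int1 n) => // x xt /=.
  by rewrite stepE.
have step_int n : \int[mu]_(x in `[0, t]) (c n <= x)%R%:R = Num.max 0 (t - c n).
  rewrite (@eq_Rintegral _ _ _ mu _ (\1_(`[c n, t]))); last by move=> x /stepE.
  rewrite /Rintegral integral_indic// (_ : _ `&` _ = `[c n, t]%classic).
    rewrite /= lebesgue_measure_itv/= lte_fin; case: ltP => ct.
      by rewrite -EFinD /= max_r// subr_ge0 ltW.
    by rewrite /= max_l// subr_le0.
  apply/seteqP; split=> x /=; first by case.
  rewrite !in_itv/= => /andP[h1 h2]; split; rewrite ?h1 ?h2//= andbT.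
  exact: le_trans h1.
elim: N => [|N [IH1 IH2]].
  rewrite big_ord0; split.
    apply: eq_integrable (integrable0 mu `[0, t]) => // x _ /=.
    by rewrite big_ord0.
  rewrite (@eq_Rintegral _ _ _ mu _ (fun=> 0)).
    by rewrite Rintegral_cst// mul0r.
  by move=> x _; rewrite big_ord0.
have stepN : mu.-integrable `[0, t] (EFin \o (fun x => D N * (c N <= x)%R%:R)).
  rewrite (_ : _ \o _ = fun x => ((D N)%:E * (EFin \o (fun x => ((c N <= x)%R%:R)%R)) x)%E).
    exact: integrableZl.
  by apply/funext => x /=; rewrite -EFinM.
split.
  rewrite (_ : _ \o _ = ((EFin \o (fun x => (\sum_(n < N) D n * (c n <= x)%R%:R)%R)) \+
    (EFin \o (fun x => (D N * (c N <= x)%R%:R)%R)))%E).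
    exact: integrableD.
  by apply/funext => x /=; rewrite big_ord_recr EFinD.
transitivity (\int[mu]_(x in `[0, t]) (\sum_(n < N) D n * (c n <= x)%R%:R +
    D N * (c N <= x)%R%:R)).
  by apply: eq_Rintegral => x _; rewrite big_ord_recr.
by rewrite RintegralD// IH2 big_ord_recr/= RintegralZl// step_int.
Qed.

Lemma counting_approxE m b e t : counting_approx m b e t =
  t / (4 * m%:R) + approx1 b e m%:R * Num.sqrt (t + 1 / 4) + approx0 b e m%:R.
Proof. by rewrite /counting_approx /approx1 /approx0; case: b; case: e; ring. Qed.

Lemma cont_counting_approx m b e : continuous (@counting_approx R m b e).
Proof.
rewrite (_ : counting_approx m b e = fun t : R =>
  t / (4 * m%:R) + approx1 b e m%:R * Num.sqrt (t + 1 / 4) + approx0 b e m%:R).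
  by have cs := @sqrt_continuous R; cont.
by apply/funext => t; exact: counting_approxE.
Qed.

Lemma sqrt_quarter t : 0 <= t -> Num.sqrt (t + 1 / 4) ^+ 2 = t + 1 / 4.
Proof. by move=> t0; rewrite sqr_sqrtr//; lra. Qed.

Lemma Rintegral_counting_approx m b e t : (1 <= m)%N -> 0 < t ->
  \int[mu]_(x in `[0, t]) counting_approx m b e x =
  approx_int b e m%:R (Num.sqrt (t + 1 / 4)).
Proof.
move=> m1 t0; set M : R := m%:R.
have M0 : M != 0 by rewrite pnatr_eq0 -lt0n.
pose F x : R := x ^+ 2 / (8 * M) +
  approx1 b e M * (2 / 3) * (Num.sqrt (x + 1 / 4) ^+ 3 - 1 / 8) + approx0 b e M * x.
have cF : continuous F by have cs := @sqrt_continuous R; rewrite /F; cont.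
transitivity (F t - F 0); last first.
  have s0 : Num.sqrt (0 + 1 / 4 : R) = 1 / 2.
    by rewrite add0r (_ : 1 / 4 = (1 / 2) ^+ 2 :> R) ?sqrtr_sqr ?ger0_norm//; field.
  rewrite /F s0 /approx_int sqrt_quarter ?ltW//.
  by field.
refine (Rintegral_FTC (F := F) t0 _ _ _).
- exact: cont_counting_approx.
- by move=> x _; exact: cF.
move=> x /andP[x0 xt]; rewrite counting_approxE -/M /F.
have x4 : 0 < x + 1 / 4 by lra.
have sx : Num.sqrt (x + 1 / 4) != 0 by rewrite gt_eqF// sqrtr_gt0.
have D0 : is_derive x 1 (fun x : R => x + 1 / 4) 1.
  by apply: is_derive_eq; rewrite addr0.
have D1 := is_derive_chain (g := fun x : R => x + 1 / 4) (is_derive1_sqrt x4) D0.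
have Dn n (y : R) : is_derive y 1 (fun y : R => y ^+ n) (n%:R * y ^+ n.-1).
  apply: DeriveDef; first exact: exprn_derivable.
  by rewrite exp_derive [_ *: _]mulr1.
have D2 := is_derive_chain (g := fun x : R => Num.sqrt (x + 1 / 4)) (Dn 3%N _) D1.
have D3 := Dn 2%N x.
apply: is_derive_eq; rewrite /GRing.scale/=.
by field; rewrite M0 sx.
Qed.

Lemma sph_eig_le n t s : 0 <= s -> s ^+ 2 = t + 1 / 4 ->
  (sph_eig n <= t) = (n%:R + 1 / 2 <= s).
Proof.
move=> s0 sE; rewrite /sph_eig -[n.+1%:R]natr1; have := ler0n R n.
move: s0 sE; set x : R := n%:R => s0 sE x0.
by apply/idP/idP => H; nra.
Qed.

Lemma count_row a n N : (n < N)%N ->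
  (\sum_(i < N) (a + 2 * i == n) = (a <= n) && ~~ odd (n - a))%N.
Proof.
move=> nN; have [/andP[an od]|H] := boolP ((a <= n)%N && ~~ odd (n - a)).
  have E : (n = a + 2 * (n - a)./2)%N.
    rewrite mul2n -[LHS](subnKC an) -[X in (_ + X)%N = _]odd_double_half.
    by rewrite (negPf od).
  have iN : ((n - a)./2 < N)%N by lia.
  rewrite (bigD1 (Ordinal iN))//= -E eqxx big1// => j /negP jn.
  by apply/eqP; rewrite eqb0; apply/negP => /eqP jE; apply: jn; apply/eqP/val_inj => /=; lia.
apply: big1 => i _; apply/eqP; rewrite eqb0; apply: contra H => /eqP <-.
by rewrite leq_addr addKn mul2n odd_double.
Qed.

Lemma size_degree_modes m b e n N : (1 <= m)%N -> (n < N)%N ->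
  size (degree_modes m b e n) =
  (\sum_(k < N | (kmin b <= k)%N) \sum_(i < N) (m * k + parity e + 2 * i == n))%N.
Proof.
move=> m1 nN; rewrite size_filter -sum1_count big_mkcond.
rewrite -[iota 0 n.+1]/(index_iota 0 n.+1) big_mkord.
rewrite [RHS]big_mkcond -(big_mkord xpredT (fun k => if (kmin b <= k)%N then
  (\sum_(i < N) (m * k + parity e + 2 * i == n))%N else 0%N)).
rewrite (big_cat_nat (leq0n n.+1) nN)/= [X in (_ + X)%N]big1_seq ?addn0.
  rewrite big_mkord; apply: eq_bigr => k _.
  by case: ifP => [/andP[-> H]|]; rewrite count_row//; [rewrite H|case: leqP => //= _ ->].
move=> k /=; rewrite mem_index_iota => /andP[nk _].
case: ifP => // _; rewrite count_row//.
by have := leq_pmull k m1; case: leqP => //; lia.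
Qed.

(** Grouping the lattice points [(k, i)] by the degree [m * k + parity e + 2 * i]. *)
Lemma lattice_sumE m b e N t s : (1 <= m)%N -> 0 <= s -> s ^+ 2 = t + 1 / 4 ->
  (forall n, n%:R + 1 / 2 <= s -> (n < N)%N) ->
  \sum_(n < N) (size (degree_modes m b e n))%:R * Num.max 0 (t - sph_eig n) =
  lattice_sum m b e N s.
Proof.
move=> m1 s0 sE hN.
pose w n : R := Num.max 0 (s ^+ 2 - (n%:R + 1 / 2) ^+ 2).
have wE n : Num.max 0 (t - sph_eig n) = w n.
  by rewrite /w sE /sph_eig -[n.+1%:R]natr1; congr Num.max; field.
have w0 n : (N <= n)%N -> w n = 0.
  move=> Nn; apply/max_idPl; rewrite subr_le0.
  have : s < n%:R + 1 / 2.
    by rewrite ltNge; apply/negP => /hN; rewrite ltnNge Nn.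
  nra.
transitivity (\sum_(n < N) \sum_(k < N | (kmin b <= k)%N) \sum_(i < N)
    (m * k + parity e + 2 * i == n)%N%:R * w n).
  apply: eq_bigr => n _; rewrite wE (@size_degree_modes _ _ _ _ N)//.
  rewrite natr_sum mulr_suml; apply: eq_bigr => k _.
  by rewrite natr_sum mulr_suml.
rewrite exchange_big /=; apply: eq_bigr => k _.
rewrite exchange_big /=; apply: eq_bigr => i _.
set n := (m * k + parity e + 2 * i)%N.
have -> : s ^+ 2 - (offset e + m%:R * k%:R + 2 * i%:R) ^+ 2 =
    s ^+ 2 - (n%:R + 1 / 2) ^+ 2.
  by rewrite /n /offset !natrD !natrM; ring.
rewrite -/(w n); have [nN|Nn] := ltnP n N.
  rewrite (bigD1 (Ordinal nN))//= eqxx mul1r big1 ?addr0// => j jn.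
  rewrite (_ : (n == j) = false) ?mul0r//; apply: contra_neqF jn => /eqP E.
  exact: val_inj.
rewrite w0// big1// => j _.
by rewrite (_ : (n == j) = false) ?mul0r//; have := ltn_ord j; lia.
Qed.

Lemma average_errorE m b e N t s : (1 <= m)%N -> 0 < t -> 0 <= s ->
  s ^+ 2 = t + 1 / 4 -> (forall n, n%:R + 1 / 2 <= s -> (n < N)%N) ->
  average_error m b e t = 1 / t * (lattice_sum m b e N s - approx_int b e m%:R s).
Proof.
move=> m1 t0 s0 sE hN; rewrite /average_error; congr (_ * _).
have hN' n : sph_eig n <= t -> (n < N)%N by rewrite (sph_eig_le _ s0 sE); exact: hN.
have ceig0 n : 0 <= sph_eig n :> R by rewrite /sph_eig mulr_ge0 ?ler0n.
have [int1 int2] := Rintegral_steps N (fun n => (size (degree_modes m b e n))%:R)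
  t ceig0.
transitivity (\int[mu]_(x in `[0, t])
  (\sum_(n < N) (size (degree_modes m b e n))%:R * (sph_eig n <= x)%R%:R -
   counting_approx m b e x)).
  apply: eq_Rintegral => x; rewrite inE /= in_itv/= => /andP[x0 xt].
  rewrite (@countingE _ m b e x N)// => n nx; apply: hN'; exact: le_trans xt.
rewrite RintegralB//; last first.
  apply: continuous_compact_integrable; first exact: segment_compact.
  by apply: continuous_subspaceT; exact: cont_counting_approx.
rewrite int2 (lattice_sumE b e m1 s0 sE hN) Rintegral_counting_approx//.
by congr (_ - approx_int _ _ _ _); rewrite -sE sqrtr_sqr ger0_norm.
Qed.

End Integration.

Theorem theorem5p6 (R : realType) (m : nat) (hm : (1 <= m)%N) (b e : bc) :
  exists (g : R -> R) (T : R),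
    [/\ continuous g,
        0 < T /\ periodic g T,
        1 / T * \int[lebesgue_measure]_(x in `[0, T]) g x = 0 &
        exists C : R, \forall t \near +oo,
          `|average_error m b e t - g (Num.sqrt (t + 1 / 4))|
            <= C * (Num.sqrt t)^-1].
Proof.
have cb := @cont_beta R.
exists (fluctuation e m%:R), 2; split.
- by rewrite /fluctuation; cont.
- split=> // x; rewrite /fluctuation -(beta_int (x - _) 1) -(beta_int (x - _ - _) 1).
  by congr ((beta _ + beta _) / _); ring.
- have cs (c : R) : continuous (fun x => beta (x - c)) by cont.
  have integ (f : R -> R) : continuous f ->
      (@lebesgue_measure R).-integrable `[0, 2] (EFin \o f).
    move=> cf; apply: continuous_compact_integrable; first exact: segment_compact.
    exact: continuous_subspaceT.
  transitivity (1 / 2 * \int[@lebesgue_measure R]_(x in `[0, 2]) ((2 * m%:R)^-1 *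
    (beta (x - ((parity e)%:R + 1 / 2)) + beta (x - ((parity e + m)%:R + 1 / 2)))));
    last first.
    rewrite RintegralZl//; last by apply: integ; apply: contD; exact: cs.
    rewrite RintegralD//; [|by apply: integ; exact: cs..].
    by rewrite !beta_mean addr0 !mulr0.
  congr (_ * _); apply: eq_Rintegral => x _.
  rewrite /fluctuation mulrC /offset natrD; congr (_ * (_ + beta _)).
  by ring.
have [C C0 HC] := @lattice_sum_asymp R m b e hm.
exists (2 * C); near=> t.
have t2 : 2 <= t by near: t; exact: nbhs_pinfty_ge.
have t0 : 0 < t by lra.
set s := Num.sqrt (t + 1 / 4).
have sE : s ^+ 2 = t + 1 / 4 by rewrite sqrt_quarter// ltW.
have s0 : 0 <= s by exact: sqrtr_ge0.
have s32 : 3 / 2 <= s by nra.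
have so : offset e <= s by rewrite /offset; case: (e) => /=; lra.
pose N := (Num.truncn s).+1.
have hN n : n%:R + 1 / 2 <= s -> (n < N)%N.
  move=> ns; have : n%:R < N%:R :> R by apply: le_lt_trans (truncnS_gt s); lra.
  by rewrite ltr_nat.
rewrite (average_errorE b e hm t0 s0 sE hN).
have := HC N s so hN; rewrite -/s.
set X := lattice_sum m b e N s - _; set g := fluctuation e m%:R s => H.
have -> : 1 / t * X - g = (X - (s ^+ 2 - 1 / 4) * g) / t.
  by rewrite sE; field; rewrite gt_eqF.
rewrite normrM normfV (gtr0_norm t0).
set q := Num.sqrt t.
have q0 : 0 < q by rewrite sqrtr_gt0.
have qE : q ^+ 2 = t by rewrite sqr_sqrtr// ltW.
have sq : s <= 2 * q by nra.
rewrite -qE ler_pdivrMr ?exprn_gt0//.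
have -> : 2 * C * q^-1 * q ^+ 2 = 2 * C * q by field; rewrite gt_eqF.
nra.
Unshelve. all: by end_near.
Qed.
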